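(* Let $q > \frac{2s}{s-2}$, and let $F: W^{1,2}(\Omega)\to\mathbb{R}$ be continuously differentiable with Lipschitz continuous derivative $F': W^{1,2}(\Omega)\to W^{-1,2}(\Omega)$ and $\sup\{\|F'(S(u))\|_{W^{-1,s}(\Omega)} : u\in U_{\mathrm{ad}}\}<\infty$. Let $f\in W^{-1,s}(\Omega)$ and $f_D\in W^{1-1/s,s}(\tilde\Gamma)$. Then the mapping $F\circ S : (U_{\mathrm{ad}},\|\cdot\|_{L^q(\Omega)})\to\mathbb{R}$ is Fréchet differentiable at every $u\in U_{\mathrm{ad}}$ with respect to feasible variations. Specifically, with $y=S(u)$ and $p=S_p(y,u)$, $$\lim_{\substack{\|\phi\|_{L^q}\to 0\\ u+\phi\in U_{\mathrm{ad}}}} \frac{\big|F(S(u+\phi)) - F(y) - \int_\Omega \phi\,\nabla y\cdot\nabla p\,dx\big|}{\|\phi\|_{L^q}} = 0 .$$ Moreover, writing $y(u)=S(u)$ and $p(u)=S_p(S(u),u)$, the mapping $$U_{\mathrm{ad}}\ni u\mapsto \nabla y(u)\cdot\nabla p(u)\in L^{\frac{2s}{s+2}}(\Omega)$$ is Lipschitz continuous with respect to the $L^q(\Omega)$-norm.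
   Context: Setting. $\Omega\subset\mathbb{R}^d$, $d\ge2$, is a bounded domain with Lipschitz boundary of class $C^{1,\alpha}$; $\tilde\Gamma,\Gamma\subset\partial\Omega$ (Dirichlet and Neumann part of the boundary) are nonempty, closed and of positive surface measure. The set $\Omega\cup\Gamma$ is regular in the sense of Gröger: a bounded set $G\subset\mathbb{R}^d$ is regular if for each $x\in\partial G$ there are an open neighbourhood $U$ of $x$ and a bi-Lipschitz map $\Phi$ from $U$ onto an open subset of $\mathbb{R}^d$ with $\Phi(x)=0$ such that $\Phi(U\cap G)$ is one of $E_1=\{|z|<1,z_d<0\}$, $E_2=\{|z|<1,z_d\le0\}$, $E_3=\{z\in E_2: z_d<0\text{ or }z_1>0\}$. Spaces. $s'=s/(s-1)$. $W^{1,p}_{\tilde\Gamma}(\Omega)$ is the closed subspace of $W^{1,p}(\Omega)$ of functions with vanishing trace on $\tilde\Gamma$; $W^{-1,p}(\Omega)$ is the dual of $W^{1,p'}_{\tilde\Gamma}(\Omega)$. $0<u_\ell\le u_u$ are fixed scalars and $U_{\mathrm{ad}}=\{u\in BV(\Omega): u_\ell\le u(x)\le u_u\text{ for a.e. }x\in\Omega\}$. Dirichlet lift. The boundary setting is such that for every $p>1$ and $f_D\in W^{1-1/p,p}(\tilde\Gamma)$ the problem $-\Delta w=0$ in $\Omega$, $w=f_D$ on $\tilde\Gamma$, $\nabla w\cdot\nu=0$ on $\Gamma$ has a unique solution $\tilde f_D\in W^{1,p}(\Omega)$, with $\|\tilde f_D\|_{W^{1,p}}\le C(p)\|f_D\|_{W^{1-1/p,p}(\tilde\Gamma)}$.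 Control-to-state operator. For $u\in U_{\mathrm{ad}}$, $S(u)$ is the unique $y\in W^{1,2}(\Omega)$ with $y-\tilde f_D\in W^{1,2}_{\tilde\Gamma}(\Omega)$ and $\int_\Omega u\nabla y\cdot\nabla v\,dx=\langle f,v\rangle$ for all $v\in W^{1,2}_{\tilde\Gamma}(\Omega)$ (weak solution of $-\mathrm{div}(u\nabla y)=f$ in $\Omega$, $y=f_D$ on $\tilde\Gamma$, $u\nabla y\cdot\nu=0$ on $\Gamma$). The exponent $s$. $s>2$ is a fixed exponent (it exists by Gröger's regularity theory) such that for every $\sigma\in[2,s]$ there is $C(\sigma)\ge0$ such that for all $f\in W^{-1,\sigma}(\Omega)$, $f_D\in W^{1-1/\sigma,\sigma}(\tilde\Gamma)$, $u\in U_{\mathrm{ad}}$: $\|S(u)\|_{W^{1,\sigma}}\le C(\sigma)(\|f_D\|_{W^{1-1/\sigma,\sigma}(\tilde\Gamma)}+\|f\|_{W^{-1,\sigma}})$. Adjoint. $F'(y)$ is regarded as an element of $W^{-1,2}(\Omega)$ (acting on $W^{1,2}_{\tilde\Gamma}(\Omega)$). $S_p(y,u)$ is the unique $p\in W^{1,2}_{\tilde\Gamma}(\Omega)$ with $\int_\Omega u\nabla p\cdot\nabla v\,dx=-\langle F'(y),v\rangle$ for all $v\in W^{1,2}_{\tilde\Gamma}(\Omega)$. A map $T:U_{\mathrm{ad}}\to Z$ into a Banach space $Z$ is Fréchet differentiable at $u$ with respect to feasible variations and a norm $\|\cdot\|_X$ if there is $T'(u)\in\mathcal{L}(X,Z)$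 with $\|T(u+\phi)-T(u)-T'(u)\phi\|_Z/\|\phi\|_X\to0$ as $\|\phi\|_X\to0$ with $u+\phi\in U_{\mathrm{ad}}$. *)

(* Defs.v *)
From HB Require Import structures.
From mathcomp Require Import all_boot all_order all_algebra.
From mathcomp Require Import all_classical all_reals all_analysis.

Set Implicit Arguments.
Unset Strict Implicit.
Unset Printing Implicit Defensive.
Import Order.TTheory GRing.Theory Num.Theory.
Import numFieldNormedType.Exports.

Local Open Scope classical_set_scope.
Local Open Scope ring_scope.

Section euclidean.
Context (R : realType) (d : nat).
Implicit Types x y : 'rV[R]_d.

Definition dotp x y : R := \sum_i x 0 i * y 0 i.

(* The norm [`|x|] of ['rV_d] is the sup norm. *)
Definition enorm x : R := Num.sqrt (dotp x x).

Definition evec (i : 'I_d) : 'rV[R]_d := delta_mx 0 i.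

Definition boundary (A : set 'rV[R]_d) : set 'rV[R]_d := closure A `\` interior A.

Definition diam (A : set 'rV[R]_d) : \bar R :=
  ereal_sup [set r | r = 0%E \/
    exists x y, [/\ A x, A y & r = (enorm (x - y))%:E]].

End euclidean.

(* Outer measure of a weighted family of cells [cell i], [i : I]. *)
Section covering_outer_measure.
Local Open Scope ereal_scope.
Context (R : realType) (T I : Type).
Variables (cell : I -> set T) (w : I -> \bar R).

Definition cover_inf (A : set T) : \bar R :=
  ereal_inf [set \sum_(k <oo) w (F k) |
    F in [set F : nat -> I | A `<=` \bigcup_k cell (F k)]].

Hypothesis w0 : exists i, w i = 0.
Hypothesis w_ge0 : forall i, 0 <= w i.

Lemma le_cover_inf : {homo cover_inf : A B / A `<=` B >-> A <= B}.
Proof.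
move=> A B AB; apply/ereal_inf_le_tmp => x [F BF <-{x}].
by exists F => //; exact: subset_trans AB BF.
Qed.

Lemma cover_inf_ge0 A : 0 <= cover_inf A.
Proof.
apply: le_ereal_inf_tmp => x [F AF <-{x}].
by apply: nneseries_ge0 => n _ _; exact: w_ge0.
Qed.

Lemma cover_inf0 : cover_inf set0 = 0.
Proof.
apply/eqP; rewrite eq_le; apply/andP; split; last exact/cover_inf_ge0.
have [i0 wi0] := w0.
apply: ereal_inf_lbound; exists (fun=> i0); first by move=> ?.
by apply: eseries0 => n _ _; exact: wi0.
Qed.

Lemma cover_inf_sigma_subadditive : sigma_subadditive cover_inf.
Proof.
move=> A; have [[i ioo]|] := pselect (exists i, cover_inf (A i) = +oo).
  rewrite (eseries_pinfty _ _ ioo) ?leey// => n _.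
  by rewrite -ltNye (lt_le_trans _ (cover_inf_ge0 _)).
rewrite -forallNE => Aoo.
suff add2e (e : {posnum R}) : cover_inf (\bigcup_n A n) <=
    \sum_(i <oo) cover_inf (A i) + e%:num%:E.
  by apply/lee_addgt0Pr => _/posnumP[].
rewrite (le_trans _ (epsilon_trick _ _ _))//; last first.
  by move=> n; exact: cover_inf_ge0.
pose P n (B : nat -> I) := A n `<=` \bigcup_k cell (B k) /\
  \sum_(k <oo) w (B k) <= cover_inf (A n) + (e%:num / (2 ^ n.+1)%:R)%:E.
have [G PG] : {G : nat -> nat -> I & forall n, P n (G n)}.
  apply: (@choice _ _ P) => n; rewrite /P /cover_inf.
  set S := (X in ereal_inf X); move infS : (ereal_inf S) => iS.
  case: iS infS => [r Sr|Soo|Soo].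
  - have en1 : (0 < e%:num / (2 ^ n.+1)%:R)%R by [].
    have /(lb_ereal_inf_adherent en1) : ereal_inf S \is a fin_num by rewrite Sr.
    move=> [x [B AnB wBx] xS].
    by exists B; split => //; rewrite wBx -Sr; exact/ltW.
  - by have := Aoo n; rewrite /cover_inf Soo.
  - suff : lbound S 0 by move/le_ereal_inf_tmp; rewrite Soo.
    by move=> /= _ [B AnB <-]; apply: nneseries_ge0 => *; exact: w_ge0.
have wG_ge0 x : 0 <= (w \o uncurry G) x by exact: w_ge0.
apply: (@le_trans _ _ (\esum_(i in setT) (w \o uncurry G) i)).
  rewrite /cover_inf; apply: ereal_inf_lbound => /=.
  have /card_esym/ppcard_eqP[f] := card_nat2.
  exists (uncurry G \o f).
    move=> t [i _] /((PG i).1 _)[j _ Gijt].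
    by exists (f^-1%FUN (i, j)) => //=; rewrite invK ?inE.
  rewrite -(esum_pred_image (w \o uncurry G) _ xpredT) ?[fun=> _]set_true//.
  by rewrite image_eq.
rewrite (_ : esum _ _ = \sum_(i <oo) \sum_(j <oo ) w (G i j)); last first.
  pose J : nat -> set (nat * nat) := fun i => [set (i, j) | j in setT].
  rewrite (_ : setT = \bigcup_k J k); last first.
    by rewrite predeqE => -[a b]; split => // _; exists a => //; exists b.
  rewrite esum_bigcupT /=; last 2 first.
    - apply/trivIsetP => i j _ _ ij.
      rewrite predeqE => -[n m] /=; split => //= -[] [_] _ [<-{n} _].
      by move=> [m' _] [] /esym/eqP; rewrite (negbTE ij).
    - by move=> /= [n m]; exact: w_ge0.
  rewrite -(image_id [set: nat]) -fun_true esum_pred_image//; last first.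
    by move=> n _; apply: esum_ge0 => *; exact: w_ge0.
  apply: eq_eseriesr => /= j _.
  rewrite -(esum_pred_image (w \o uncurry G) (pair j) predT)//=; last first.
    by move=> ? ? _ _; exact: (@can_inj _ _ _ snd).
  by congr esum; rewrite predeqE => -[a b]; split; move=> [i _ <-]; exists i.
apply: lee_lim.
- apply: is_cvg_nneseries => n *.
  by apply: nneseries_ge0 => m *; exact: (wG_ge0 (n, m)).
- by apply: is_cvg_nneseries => n *; apply: adde_ge0 => //; exact: cover_inf_ge0.
- by near=> n; apply: lee_sum => i _; exact: (PG i).2.
Unshelve. all: by end_near. Qed.

End covering_outer_measure.

(* The restriction of an outer measure to its Caratheodory-measurable sets. *)
Definition caratheodory_measure (R : realType) (T : pointedType)
    (mu : {outer_measure set T -> \bar R}) :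
    {measure set (caratheodory_type mu) -> \bar R} := mu.

Section lebesgue.
Context (R : realType) (n : nat).

Definition box (ab : 'rV[R]_n.+1 * 'rV[R]_n.+1) : set 'rV[R]_n.+1 :=
  [set x | forall i, ab.1 0 i <= x 0 i <= ab.2 0 i].

Definition box_volume (ab : 'rV[R]_n.+1 * 'rV[R]_n.+1) : \bar R :=
  (\prod_i Num.max 0 (ab.2 0 i - ab.1 0 i))%:E.

Definition lebesgue_outer : set 'rV[R]_n.+1 -> \bar R :=
  cover_inf box box_volume.

Lemma box_volume_eq0 : exists ab, box_volume ab = 0%E.
Proof.
exists (0, 0); rewrite /box_volume; congr EFin.
by rewrite big_ord_recl /= !mxE subrr maxxx mul0r.
Qed.

Lemma box_volume_ge0 ab : (0 <= box_volume ab)%E.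
Proof. by rewrite lee_fin prodr_ge0// => i _; rewrite le_max lexx. Qed.

HB.instance Definition _ := isOuterMeasure.Build R 'rV[R]_n.+1 lebesgue_outer
  (cover_inf0 box box_volume_eq0 box_volume_ge0)
  (cover_inf_ge0 box box_volume_ge0)
  (@le_cover_inf _ _ _ box box_volume)
  (@cover_inf_sigma_subadditive _ _ _ box box_volume box_volume_ge0).

Definition lebesgue := caratheodory_measure lebesgue_outer.

End lebesgue.

(* [k.+1]-dimensional Hausdorff measure, normalised to agree with the
   [k.+1]-dimensional volume. *)
Section hausdorff.
Local Open Scope ereal_scope.
Context (R : realType) (d k : nat).

Definition ball_volume : R :=
  fine (lebesgue R k [set x : 'rV[R]_k.+1 | (enorm x <= 1)%R]).

Definition hausdorff_weight (delta : R) (A : set 'rV[R]_d) : \bar R :=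
  if diam A <= delta%:E
  then (ball_volume / 2 ^+ k.+1)%:E * diam A ^+ k.+1 else +oo.

Definition hausdorff_pre (delta : R) : set 'rV[R]_d -> \bar R :=
  cover_inf id (hausdorff_weight delta).

Definition hausdorff (A : set 'rV[R]_d) : \bar R :=
  ereal_sup [set hausdorff_pre delta A | delta in [set r : R | (0 < r)%R]].

Lemma diam_ge0 (A : set 'rV[R]_d) : 0 <= diam A.
Proof. by apply: ereal_sup_ubound; left. Qed.

Lemma diam0 : diam (set0 : set 'rV[R]_d) = 0.
Proof.
apply/eqP; rewrite eq_le diam_ge0 andbT.
by apply: ge_ereal_sup => r [->//|[x [y []]]].
Qed.

Lemma hausdorff_weight_ge0 delta A : 0 <= hausdorff_weight delta A.
Proof.
rewrite /hausdorff_weight; case: ifPn => // _.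
rewrite mule_ge0 ?expe_ge0 ?diam_ge0// lee_fin divr_ge0 ?exprn_ge0//.
by rewrite fine_ge0.
Qed.

Lemma hausdorff_weight_eq0 delta : (0 < delta)%R ->
  exists A, hausdorff_weight delta A = 0.
Proof.
move=> d0; exists set0; rewrite /hausdorff_weight diam0 lee_fin ltW//.
by rewrite expeS mul0e mule0.
Qed.

Lemma hausdorff0 : hausdorff set0 = 0.
Proof.
apply/eqP; rewrite eq_le; apply/andP; split.
  apply: ge_ereal_sup => _ [delta /= d0 <-].
  rewrite /hausdorff_pre cover_inf0//; first exact: hausdorff_weight_eq0.
  exact: hausdorff_weight_ge0.
apply: ereal_sup_ubound; exists 1%R => //=.
rewrite /hausdorff_pre cover_inf0//; first exact: hausdorff_weight_eq0.
exact: hausdorff_weight_ge0.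
Qed.

Lemma hausdorff_ge0 A : 0 <= hausdorff A.
Proof.
apply: le_ereal_sup_tmp; exists (hausdorff_pre 1 A); first by exists 1%R => /=.
exact/cover_inf_ge0/hausdorff_weight_ge0.
Qed.

Lemma le_hausdorff : {homo hausdorff : A B / A `<=` B >-> A <= B}.
Proof.
move=> A B AB; apply: ge_ereal_sup => _ [delta /= d0 <-].
apply: le_ereal_sup_tmp; exists (hausdorff_pre delta B); first by exists delta.
exact: le_cover_inf.
Qed.

Lemma hausdorff_sigma_subadditive : sigma_subadditive hausdorff.
Proof.
move=> F; apply: ge_ereal_sup => _ [delta /= d0 <-].
apply: (le_trans (cover_inf_sigma_subadditive _ (hausdorff_weight_ge0 delta) _)).
apply: lee_nneseries => i *; first exact/cover_inf_ge0/hausdorff_weight_ge0.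
by apply: ereal_sup_ubound; exists delta.
Qed.

HB.instance Definition _ := isOuterMeasure.Build R 'rV[R]_d hausdorff
  hausdorff0 hausdorff_ge0 le_hausdorff hausdorff_sigma_subadditive.

End hausdorff.

Section domain.
Context (R : realType) (n : nat).
Notation point := 'rV[R]_n.+2.
Implicit Types (x z : point) (Omega G : set point).

Definition leb := lebesgue R n.+1.

(* Surface measure: the (d-1)-dimensional Hausdorff measure on R^d, d = n.+2. *)
Definition surf := caratheodory_measure (@hausdorff R n.+2 n).

Definition C1alpha (m : nat) (alpha : R) (g : 'rV[R]_m -> R) :=
  (forall i a, derivable g a (evec R i)) /\
  exists H : R, forall i a b,
    `|'D_(evec R i) g a - 'D_(evec R i) g b| <= H * enorm (a - b) `^ alpha.

(* Bounded domain which, near each boundary point and in suitable orthonormal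
   coordinates, is the strict subgraph of a C^{1,alpha} function. *)
Definition C1alpha_domain (alpha : R) Omega :=
  [/\ open Omega, connected Omega, Omega !=set0, bounded_set Omega &
    forall x, boundary Omega x ->
    exists (Q : 'M[R]_n.+2) (r : R) (g : 'rV[R]_n.+1 -> R),
    [/\ Q *m Q^T = 1%:M, 0 < r, C1alpha alpha g &
      forall z, enorm (z - x) < r ->
        (Omega z <-> (z *m Q) 0 ord_max < g (col' ord_max (z *m Q)))]].

Definition E1 : set point := [set z | enorm z < 1 /\ z 0 ord_max < 0].
Definition E2 : set point := [set z | enorm z < 1 /\ z 0 ord_max <= 0].
Definition E3 : set point :=
  [set z | E2 z /\ (z 0 ord_max < 0 \/ 0 < z 0 ord0)].

Definition groger_regular G :=
  bounded_set G /\
  forall x, boundary G x ->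
  exists (U : set point) (Phi : point -> point) (L : R),
  [/\ open U /\ U x, 0 < L,
    (forall a b, U a -> U b ->
      L^-1 * enorm (a - b) <= enorm (Phi a - Phi b) <= L * enorm (a - b)),
    open (Phi @` U) /\ Phi x = 0 &
    let V := Phi @` (U `&` G) in [\/ V = E1, V = E2 | V = E3]].

End domain.

Section sobolev.
Context (R : realType) (n : nat).
Notation point := 'rV[R]_n.+2.
Notation leb := (leb R n).
Notation surf := (surf R n).
Implicit Types (x : point) (Omega : set point) (p : R) (phi : point -> R).

Definition partial (i : 'I_n.+2) phi : point -> R :=
  fun x => 'D_(evec R i) phi x.

Fixpoint Ck (k : nat) phi : Prop :=
  continuous phi /\
  if k is k'.+1 then
    forall i, (forall x, derivable phi x (evec R i)) /\ Ck k' (partial i phi)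
  else True.

Definition smooth phi := forall k, Ck k phi.

Definition compactly_supported_in Omega phi :=
  let K := closure [set x | phi x != 0] in compact K /\ K `<=` Omega.

Definition Lp Omega p : set (point -> R) :=
  [set f | f \_ Omega \in Lfun leb p%:E].

Definition Lpnorm Omega p (f : point -> R) : \bar R :=
  'N[leb]_p%:E[EFin \o (f \_ Omega)].

Definition Lpsurf (S : set point) p : set (point -> R) :=
  [set f | f \_ S \in Lfun surf p%:E].

Definition Lpsurfnorm (S : set point) p (f : point -> R) : \bar R :=
  'N[surf]_p%:E[EFin \o (f \_ S)].

(* An element of W^{1,p} is carried as the pair of the function and its weak
   gradient; the latter is a.e. determined by the former. *)
Definition sob := ((point -> R) * (point -> point))%type.

Definition grad (y : sob) : point -> point := y.2.

Definition weak_gradient Omega (y : sob) :=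
  forall phi, smooth phi -> compactly_supported_in Omega phi ->
  forall i, \int[leb]_(x in Omega) (y.1 x * partial i phi x) =
          - \int[leb]_(x in Omega) (grad y x 0 i * phi x).

Definition W1 Omega p : set sob :=
  [set y | [/\ Lp Omega p y.1, (forall i, Lp Omega p (fun x => grad y x 0 i)) &
               weak_gradient Omega y]].

Definition W1norm Omega p (y : sob) : \bar R :=
  (Lpnorm Omega p y.1 + Lpnorm Omega p (fun x => enorm (grad y x)))%E.

Definition classical phi : sob := (phi, fun x => \row_i partial i phi x).

(* For a Lipschitz domain, this is the graph of the trace operator
   W^{1,p}(Omega) -> L^p(boundary Omega), the continuous extension of the
   restriction map on functions smooth up to the boundary. *)
Definition has_trace Omega p (y : sob) (g : point -> R) :=
  Lpsurf (boundary Omega) p g /\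
  exists phi : nat -> point -> R,
    [/\ (forall k, smooth (phi k)),
      W1norm Omega p (y - classical (phi k)) @[k --> \oo] --> 0%E &
      Lpsurfnorm (boundary Omega) p (phi k - g) @[k --> \oo] --> 0%E].

Definition trace_eq_on Omega p (S : set point) (y : sob) (h : point -> R) :=
  exists2 g, has_trace Omega p y g &
    {ae surf, forall x, S x -> g x = h x}.

Definition W1D Omega (GD : set point) p : set sob :=
  [set y | W1 Omega p y /\ trace_eq_on Omega p GD y (cst 0)].

(* Sobolev-Slobodeckij space W^{theta,p}, theta = 1 - 1/p, on a piece S of the
   (d-1)-dimensional boundary. *)
Definition slobodeckij_seminorm_pow (S : set point) p (h : point -> R) : \bar R :=
  (\int[surf]_(x in S) \int[surf]_(y in S)
    (`|h x - h y| `^ p /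
     enorm (x - y : point) `^ (n.+1%:R + (1 - p^-1) * p))%:E)%E.

Definition slobodeckij_norm (S : set point) p (h : point -> R) : \bar R :=
  ((Lpsurfnorm S p h `^ p + slobodeckij_seminorm_pow S p h) `^ p^-1)%E.

Definition slobodeckij (S : set point) p : set (point -> R) :=
  [set h | Lpsurf S p h /\ (slobodeckij_seminorm_pow S p h < +oo)%E].

Definition bv_variation Omega (u : point -> R) : \bar R :=
  ereal_sup [set (\int[leb]_(x in Omega)
                   (u x * \sum_i partial i (fun z => phi z 0 i) x))%:E
    | phi in [set phi : point -> point |
        [/\ (forall i, Ck 1 (fun x => phi x 0 i)),
          (forall i, compactly_supported_in Omega (fun x => phi x 0 i)) &
          (forall x, enorm (phi x) <= 1)]]].

Definition BV Omega : set (point -> R) :=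
  [set u | Lp Omega 1 u /\ (bv_variation Omega u < +oo)%E].

End sobolev.

(* Functionals on a subset X of an ambient space V, X being a linear subspace
   with (semi)norm N. Functionals are arbitrary outside of X. *)
Section functionals.
Context (R : realType) (V : lmodType R).
Implicit Types (X : set V) (N : V -> \bar R) (f : V -> R).

Definition dual_norm X N f : \bar R :=
  ereal_sup [set `|f v|%:E | v in [set v | X v /\ (N v <= 1)%E]].

Definition dual_space X N : set (V -> R) :=
  [set f | (forall (a : R) v w, X v -> X w -> f (a *: v + w) = a * f v + f w) /\
           (dual_norm X N f < +oo)%E].

Definition continuously_differentiable X N (F : V -> R) (DF : V -> V -> R) :=
  [/\ (forall y, X y -> dual_space X N (DF y)),
    (forall y, X y -> forall e : R, 0 < e -> exists2 delta : R, 0 < delta &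
      forall h, X h -> (N h < delta%:E)%E ->
        (`|F (y + h) - F y - DF y h|%R%:E <= e%:E * N h)%E) &
    (forall y, X y -> forall e : R, 0 < e -> exists2 delta : R, 0 < delta &
      forall z, X z -> (N (z - y)%R < delta%:E)%E ->
        (dual_norm X N (DF z - DF y)%R <= e%:E)%E)].

(* Frechet differentiability at u with derivative DT, with respect to
   variations phi such that u + phi stays in U, and to the norm N on X. *)
Definition frechet_feasible X N (U : set V) (T : V -> R) (u : V) (DT : V -> R) :=
  dual_space X N DT /\
  forall e : R, 0 < e -> exists2 delta : R, 0 < delta &
    forall phi, X phi -> U (u + phi) -> (0 < N phi < delta%:E)%E ->
      `|T (u + phi) - T u - DT phi| / fine (N phi) < e.

End functionals.

Section problem.
Context (R : realType) (n : nat).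
Notation point := 'rV[R]_n.+2.
Notation leb := (leb R n).
Implicit Types (Omega GD : set point) (p : R) (u : point -> R) (y : sob R n).

Definition conj_exp p : R := p / (p - 1).

(* W^{-1,p} *)
Definition Wneg Omega GD p : set (sob R n -> R) :=
  dual_space (W1D Omega GD (conj_exp p)) (@W1norm R n Omega (conj_exp p)).

Definition Wnegnorm Omega GD p (f : sob R n -> R) : \bar R :=
  dual_norm (W1D Omega GD (conj_exp p)) (@W1norm R n Omega (conj_exp p)) f.

Definition Uad Omega (ul uu : R) : set (point -> R) :=
  [set u | BV Omega u /\ {ae leb, forall x, Omega x -> ul <= u x <= uu}].

Definition energy Omega u y v : R :=
  \int[leb]_(x in Omega) (u x * dotp (grad y x) (grad v x)).

(* Weak solution in W^{1,p} of -Laplace(w) = 0 in Omega, w = fD on GD, with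
   homogeneous Neumann condition on the rest of the boundary. *)
Definition is_lift Omega GD p (fD : point -> R) w :=
  [/\ W1 Omega p w, trace_eq_on Omega p GD w fD &
    forall v, W1D Omega GD (conj_exp p) v -> energy Omega (cst 1) w v = 0].

(* y = S(u) for the data f, fD *)
Definition is_state Omega GD (f : sob R n -> R) (fD : point -> R) u y :=
  [/\ W1 Omega 2 y,
    (exists2 w, is_lift Omega GD 2 fD w & W1D Omega GD 2 (y - w)) &
    forall v, W1D Omega GD 2 v -> energy Omega u y v = f v].

(* p = S_p(y, u), where g = F'(y) *)
Definition is_adjoint Omega GD (g : sob R n -> R) u (p : sob R n) :=
  W1D Omega GD 2 p /\
  forall v, W1D Omega GD 2 v -> energy Omega u p v = - g v.

Definition lift_well_posed Omega GD := forall p, 1 < p ->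
  exists2 C : R, 0 <= C & forall fD, slobodeckij GD p fD ->
    (exists2 w, is_lift Omega GD p fD w &
       (W1norm Omega p w <= C%:E * slobodeckij_norm GD p fD)%E) /\
    (forall w w', is_lift Omega GD p fD w -> is_lift Omega GD p fD w' ->
       W1norm Omega p (w - w') = 0%E).

Definition regularity_exponent Omega GD (ul uu s : R) :=
  2 < s /\
  forall sigma, 2 <= sigma <= s -> exists2 C : R, 0 <= C &
    forall f fD u y, Wneg Omega GD sigma f -> slobodeckij GD sigma fD ->
      Uad Omega ul uu u -> is_state Omega GD f fD u y ->
      W1 Omega sigma y /\
      (W1norm Omega sigma y <=
        C%:E * (slobodeckij_norm GD sigma fD + Wnegnorm Omega GD sigma f))%E.

End problem.

(* Main.v *)
(* The W^{1,s} norms of the states and of the adjoints are bounded uniformly on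
   U_ad, by the regularity estimate for sigma = s: the adjoint for u is the state
   for the right-hand side -F'(S u) and zero Dirichlet data.  The difference
   S u1 - S u2 vanishes on GD and is the state, for the coefficient u1, of the
   functional v |-> int (u2 - u1) grad (S u2) . grad v; since
   1/q + 1/s + 1/2 < 1, Hoelder's inequality bounds the dual norm of the latter
   by O(|u1 - u2|_q), and the regularity estimate for sigma = 2 makes S
   Lipschitz from L^q to W^{1,2}.  The Lipschitz continuity of F' yields the same
   for the adjoints, and L^2 . L^s is contained in L^(2s/(s+2)), which gives the
   second claim.  As for the first one, with h = S (u + phi) - S u, the adjoint
   equation tested with h and the two state equations tested with p give
   <F'(y), h> = int phi grad y . grad p + int phi grad h . grad p,
   where the last integral is O(|phi|_q^2), and F is differentiable at y.

   That W^{1,2} functions vanishing on GD are closed under subtraction rests on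
   Minkowski's inequality for the smooth approximants of the traces, hence on the
   Caratheodory measurability of open sets for the Lebesgue and the Hausdorff
   outer measures. *)
Require Import Defs.
From HB Require Import structures.
From mathcomp Require Import all_boot all_order all_algebra.
From mathcomp Require Import all_classical all_reals all_analysis.
From mathcomp Require Import measurable_realfun ring lra.

Set Implicit Arguments.
Unset Strict Implicit.
Unset Printing Implicit Defensive.
Import Order.TTheory GRing.Theory Num.Theory.
Import numFieldNormedType.Exports.

Local Open Scope classical_set_scope.
Local Open Scope ring_scope.

(** * Borel sets and Caratheodory measurability *)

Section euclidean_norm.
Context (R : realType) (d : nat).
Implicit Types x y z : 'rV[R]_d.

Lemma dotpC x y : dotp x y = dotp y x.
Proof. by apply: eq_bigr => i _; rewrite mulrC. Qed.

Lemma dotpDl x y z : dotp (x + y) z = dotp x z + dotp y z.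
Proof. by rewrite -big_split; apply: eq_bigr => i _; rewrite mxE mulrDl. Qed.

Lemma dotpZl (a : R) x y : dotp (a *: x) y = a * dotp x y.
Proof. by rewrite /dotp mulr_sumr; apply: eq_bigr => i _; rewrite mxE mulrA. Qed.

Lemma dotpDr x y z : dotp x (y + z) = dotp x y + dotp x z.
Proof. by rewrite dotpC dotpDl !(dotpC x). Qed.

Lemma dotpZr (a : R) x y : dotp x (a *: y) = a * dotp x y.
Proof. by rewrite dotpC dotpZl dotpC. Qed.

Lemma dotpNl x y : dotp (- x) y = - dotp x y.
Proof. by rewrite -scaleN1r dotpZl mulN1r. Qed.

Lemma dotpBl x y z : dotp (x - y) z = dotp x z - dotp y z.
Proof. by rewrite dotpDl dotpNl. Qed.

Lemma dotpBr x y z : dotp x (y - z) = dotp x y - dotp x z.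
Proof. by rewrite dotpC dotpBl !(dotpC x). Qed.

Lemma dotp_ge0 x : 0 <= dotp x x.
Proof. by apply: sumr_ge0 => i _; rewrite -expr2 sqr_ge0. Qed.

Lemma enorm_ge0 x : 0 <= enorm x.
Proof. exact: sqrtr_ge0. Qed.

Lemma sqr_enorm x : enorm x ^+ 2 = dotp x x.
Proof. by rewrite sqr_sqrtr// dotp_ge0. Qed.

Lemma enorm0 : enorm (0 : 'rV[R]_d) = 0.
Proof. by rewrite /enorm /dotp big1 ?sqrtr0// => i _; rewrite mxE mul0r. Qed.

Lemma coord_le_enorm x i : `|x 0 i| <= enorm x.
Proof.
rewrite -ler_sqr ?nnegrE ?enorm_ge0// sqr_enorm real_normK ?num_real//.
rewrite /dotp (bigD1 i)//= -expr2 lerDl.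
by apply: sumr_ge0 => j _; rewrite -expr2 sqr_ge0.
Qed.

Lemma enorm_eq0 x : enorm x = 0 -> x = 0.
Proof.
move=> x0; apply/rowP => i; rewrite mxE; apply/eqP.
by rewrite -normr_le0 -x0 coord_le_enorm.
Qed.

(** The squared norm of [dotp y y *: x - dotp x y *: y] is nonnegative; expanding it and dividing by
    [dotp y y] gives the claim. *)
Lemma CauchySchwarz_dotp x y : `|dotp x y| <= enorm x * enorm y.
Proof.
have [->|y0] := eqVneq y 0.
  by rewrite dotpC /dotp big1 ?normr0 ?mulr_ge0 ?enorm_ge0// => i _; rewrite mxE mul0r.
rewrite -ler_sqr ?nnegrE ?mulr_ge0 ?enorm_ge0// real_normK ?num_real//.
rewrite exprMn !sqr_enorm.
have yy : 0 < dotp y y.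
  by rewrite -sqr_enorm exprn_gt0// lt0r enorm_ge0 andbT; apply: contra_neq y0 => /enorm_eq0.
have := dotp_ge0 (dotp y y *: x - dotp x y *: y).
rewrite !(dotpBl, dotpBr, dotpZl, dotpZr) (dotpC y x) => H.
rewrite -(ler_pM2l yy); lra.
Qed.

Lemma enormD x y : enorm (x + y) <= enorm x + enorm y.
Proof.
rewrite -ler_sqr ?nnegrE ?addr_ge0 ?enorm_ge0// sqrrD !sqr_enorm.
rewrite dotpDl !dotpDr (dotpC y x).
have := le_trans (ler_norm _) (CauchySchwarz_dotp x y); lra.
Qed.

End euclidean_norm.

Section borel_caratheodory.
Context (R : realType) (m : nat) (mu : {outer_measure set 'rV[R]_m -> \bar R}).

(** Measurability of the half-spaces is measurability of the coordinates, so rational boxes are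
    measurable. The norm of ['rV_m] being the sup norm, every point of an open set lies in such a
    box inside the set, and there are countably many boxes. *)
Lemma open_caratheodory :
  (forall i a, mu.-caratheodory [set x : 'rV[R]_m | x 0 i < a]) ->
  forall U, open U -> mu.-caratheodory U.
Proof.
pose T := caratheodory_type mu.
move=> mlt; have mx i : measurable_fun setT (fun x : T => (x : 'rV[R]_m) 0 i).
  apply: (measurability _ (RGenInftyO.measurableE R)) => // _ [_ [a ->] <-].
  rewrite setTI (_ : _ @^-1` _ = [set x : 'rV[R]_m | x 0 i < a]); first exact: mlt.
  by apply/seteqP; split => x /=; rewrite in_itv.
move=> U oU.
pose B (ab : 'rV[rat]_m * 'rV[rat]_m) : set T := \bigcap_(i in [set: 'I_m])
  ((fun x : T => (x : 'rV[R]_m) 0 i) @^-1` `](ratr (ab.1 0 i)), (ratr (ab.2 0 i))[).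
have mB ab : measurable (B ab).
  apply: fin_bigcap_measurable => // i _.
  rewrite -[X in measurable X]setTI; exact: mx.
suff -> : U = \bigcup_ab (if `[< B ab `<=` U >] then B ab else set0).
  apply: (@countable_bigcupT_measurable _ T) => // ab.
  by case: ifPn => _ //; exact: measurable0.
apply/seteqP; split => [x Ux|x [ab _]]; last by case: asboolP => // + Bx; exact.
have /nbhs_ballP[e /= e0 eU] : nbhs x U by exact: open_nbhs_nbhs.
have [a ax] : exists a : 'rV[rat]_m, forall i, ratr (a 0 i) \in `](x 0 i - e), (x 0 i)[.
  have /choice[f fP] i : exists q, ratr q \in `](x 0 i - e), (x 0 i)[.
    by apply: rat_in_itvoo; rewrite ltrBlDr ltrDl.
  by exists (\row_i f i) => i; rewrite mxE.
have [b bx] : exists b : 'rV[rat]_m, forall i, ratr (b 0 i) \in `](x 0 i), (x 0 i + e)[.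
  have /choice[f fP] i : exists q, ratr q \in `](x 0 i), (x 0 i + e)[.
    by apply: rat_in_itvoo; rewrite ltrDl.
  by exists (\row_i f i) => i; rewrite mxE.
exists (a, b) => //; case: asboolP => [_ i _|] /=.
  by rewrite in_itv/= (itvP (ax i)) (itvP (bx i)).
move=> []; move=> y By; apply: eU; split => // j i; rewrite (ord1 j).
have /= := By i Logic.I; rewrite in_itv/= => /andP[ay yb].
rewrite /ball/= ltr_norml.
have := ax i; have := bx i; rewrite !in_itv/= => /andP[? ?] /andP[? ?].
by apply/andP; split; lra.
Qed.

Lemma continuous_caratheodory (f : 'rV[R]_m -> R) :
  (forall i a, mu.-caratheodory [set x : 'rV[R]_m | x 0 i < a]) ->
  continuous f -> measurable_fun setT (f : caratheodory_type mu -> R).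
Proof.
move=> mlt /continuousP cf.
apply: (measurability _ (RGenInftyO.measurableE R)) => // _ [_ [a ->] <-].
rewrite setTI; apply: open_caratheodory => //; apply: cf; exact: lray_open.
Qed.

(* Caratheodory's criterion: exhaust [x_i < a] by [x_i <= a - 1/k.+1]; the
   slices in between, indexed two apart, are at positive distance, so that the
   series of their outer measures converges. *)
Lemma metric_halfspace_caratheodory :
  (forall (A B : set 'rV[R]_m) (e : R), 0 < e ->
    (forall x y, A x -> B y -> e <= enorm (x - y)) ->
    (mu A + mu B <= mu (A `|` B))%E) ->
  forall i a, mu.-caratheodory [set x : 'rV[R]_m | x 0 i < a].
Proof.
move=> metric i a; set E := [set x | _].
have gap (A B : set 'rV[R]_m) (b c : R) : b < c ->
    (forall x, A x -> x 0 i <= b) -> (forall x, B x -> c <= x 0 i) ->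
    (mu A + mu B <= mu (A `|` B))%E.
  move=> bc Ab Bc; apply: (metric _ _ (c - b)); first by rewrite subr_gt0.
  move=> x y /Ab xb /Bc cy; apply: le_trans (coord_le_enorm _ i).
  by rewrite !mxE distrC; apply: le_trans (ler_norm _); lra.
pose r k : R := a - k.+1%:R^-1.
have rlt k l : (k < l)%N -> r k < r l.
  by move=> kl; rewrite /r ltrD2l ltrN2 ltf_pV2 ?posrE// ltr_nat.
apply: le_caratheodory_measurable => X.
have [->|Xoo] := eqVneq (mu X) +oo%E; first by rewrite leey.
have {}Xoo : (mu X < +oo)%E by rewrite ltey.
pose L k : set 'rV[R]_m := X `&` [set x | x 0 i <= r k].
pose D k : set 'rV[R]_m := X `&` [set x | r k < x 0 i <= r k.+1].
have LX k : (mu (L k) <= mu X)%E by apply: le_outer_measure => x [].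
(* Keeping two consecutive truncations treats even and odd slices in a single induction: [D N.+1]
   lies above the level [r N.+1], at positive distance from [L N], and both fit into [L N.+2]. *)
have sumD N : (\sum_(j < N) mu (D j.+1) <= mu (L N) + mu (L N.+1))%E.
  elim: N => [|N IH]; first by rewrite big_ord0 adde_ge0.
  rewrite big_ord_recr/= (le_trans (leeD2r _ IH))// addeAC addeC leeD2l//.
  apply: le_trans (gap _ _ (r N) (r N.+1) (rlt _ _ _) _ _) _ => //.
  - by move=> x [].
  - by move=> x [_ /= /andP[/ltW]].
  apply: le_outer_measure => x [[Xx xr]|[Xx /andP[_ xr]]]; split => //=.
  by rewrite (le_trans xr)// ltW// rlt.
have sumDoo : (\sum_(0 <= j <oo) mu (D j.+1) < +oo)%E.
  apply: (@le_lt_trans _ _ (mu X + mu X)%E); last by rewrite lte_add_pinfty.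
  apply: lime_le; first by apply: is_cvg_nneseries => *.
  by apply: nearW => N; rewrite big_mkord (le_trans (sumD N))// leeD.
have tail0 := nneseries_tail_cvg sumDoo (fun k _ => outer_measure_ge0 mu (D k.+1)).
(* The part of [X] in [E] is covered by [L k.+1], which stays at distance at least 1/(k+2) from the
   complement of [E], and by the slices from index [k] on, whose total measure tends to 0. *)
have bound k : (mu (X `&` E) + mu (X `&` ~` E) <=
    mu X + \sum_(k <= j <oo) mu (D j.+1))%E.
  have EDL : X `&` E `<=` L k.+1 `|` \bigcup_(j in ~` `I_k) D j.+1.
    move=> x [Xx xa].
    have [N rN] : exists N, x 0 i <= r N.
      have /ltr_add_invr[N xN] : x 0 i < a by [].
      by exists N; rewrite /r; rewrite lerBrDr ltW.
    elim: N rN => [|N IH] xN.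
      by left; split => //=; rewrite (le_trans xN)// ltW// rlt.
    have [/IH//|Nx] := leP (x 0 i) (r N).
    have [Nk|kN] := leqP N k.
      left; split => //=; rewrite (le_trans xN)// le_eqVlt.
      by move: Nk; rewrite leq_eqVlt => /predU1P[->|Nk]; rewrite ?eqxx// rlt ?orbT.
    right; exists N.-1 => /=; first by apply/negP; rewrite -leqNgt -ltnS (ltn_predK kN).
    by split => //=; rewrite (ltn_predK kN) Nx xN.
  apply: (@le_trans _ _ (mu (L k.+1) + \sum_(k <= j <oo) mu (D j.+1) +
      mu (X `&` ~` E))%E).
    rewrite leeD2r//; apply: (le_trans (le_outer_measure mu _ _ EDL)).
    apply: (le_trans (outer_measureU2 mu _ _)); rewrite leeD2l//.
    exact: (outer_measure_sigma_subadditive_tail mu k (fun j => D j.+1)).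
  rewrite addeAC leeD2r//; apply: (@le_trans _ _ (mu (L k.+1 `|` (X `&` ~` E)))).
    apply: (gap _ _ (r k.+1) a).
    - by rewrite /r ltrBlDr ltrDl invr_gt0.
    - by move=> x [].
    - by move=> x [_ /= /negP]; rewrite -leNgt.
  by apply: le_outer_measure => x [[]|[]].
rewrite -[leRHS]adde0.
have cv : (mu X + \sum_(k <= j <oo) mu (D j.+1) @[k --> \oo] --> mu X + 0)%E.
  by apply: cvgeD => //; [rewrite fin_num_adde_defl|exact: cvg_cst].
rewrite -(cvg_lim _ cv)//; apply: lime_ge; first by apply/cvg_ex; eexists; exact: cv.
exact: nearW.
Qed.

End borel_caratheodory.

(** * Half-spaces and bounded sets for the Lebesgue outer measure *)

Section lebesgue_caratheodory.
Context (R : realType) (n : nat).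
Implicit Types (ab : 'rV[R]_n.+1 * 'rV[R]_n.+1).

(** Cutting the interval from [a] to [b] at [c] preserves the length; when [c] is outside the
    interval or the interval is empty, the truncation at 0 discards the degenerate pieces. *)
Lemma max0_split (a b c : R) : Num.max 0 (b - a) =
  Num.max 0 (Num.min b c - a) + Num.max 0 (b - Num.max a c).
Proof.
have [bc|cb] := leP b c; have [ac|ca] := leP a c;
  have [?|?] := leP 0 (b - a); have [?|?] := leP 0 (c - a);
  have [?|?] := leP 0 (b - c); lra.
Qed.

Lemma box_volume_split ab i c :
  box_volume ab =
  (box_volume (ab.1, \row_j if j == i then Num.min (ab.2 0 j) c else ab.2 0 j)%R +
   box_volume (\row_j if j == i then Num.max (ab.1 0 j) c else ab.1 0 j, ab.2)%R)%E.
Proof.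
rewrite /box_volume -EFinD; congr EFin.
have D (h : 'I_n.+1 -> R) : \prod_j h j = h i * \prod_(j | j != i) h j.
  by rewrite (bigD1 i).
rewrite !D /= !mxE eqxx.
have off (a b : 'rV[R]_n.+1) : (forall j, j != i -> a 0 j = ab.1 0 j) ->
    (forall j, j != i -> b 0 j = ab.2 0 j) ->
    \prod_(j | j != i) Num.max 0 (b 0 j - a 0 j) =
    \prod_(j | j != i) Num.max 0 (ab.2 0 j - ab.1 0 j).
  by move=> ha hb; apply: eq_bigr => j ji; rewrite ha ?hb.
rewrite !off//; last 2 first.
  by move=> j ji; rewrite mxE (negbTE ji).
  by move=> j ji; rewrite mxE (negbTE ji).
rewrite -mulrDl; congr (_ * _).
exact: max0_split.
Qed.

(** Each box of a cover is cut at level [c] of coordinate [i]. The lower pieces [F1] cover the part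
    in the half-space, the upper pieces [F2] the rest, and the volumes add up exactly. *)
Lemma lebesgue_halfspace i c :
  (@lebesgue_outer R n).-caratheodory [set x : 'rV[R]_n.+1 | x 0 i < c].
Proof.
apply: le_caratheodory_measurable => X /=.
rewrite {3}/lebesgue_outer; apply: le_ereal_inf_tmp => _ [F XF <-].
pose F1 k := ((F k).1, \row_j if j == i then Num.min ((F k).2 0 j) c else (F k).2 0 j).
pose F2 k := (\row_j if j == i then Num.max ((F k).1 0 j) c else (F k).1 0 j, (F k).2).
have -> : (\sum_(k <oo) box_volume (F k) =
    \sum_(k <oo) box_volume (F1 k) + \sum_(k <oo) box_volume (F2 k))%E.
  rewrite -nneseriesD; last 2 first.
  - by move=> *; exact: box_volume_ge0.
  - by move=> *; exact: box_volume_ge0.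
  by apply: eq_eseriesr => k _; exact: box_volume_split.
apply: leeD; apply: ereal_inf_lbound.
- exists F1 => // x [/XF[k _ Fkx] /= xc]; exists k => // j; rewrite mxE.
  by have := Fkx j; case: eqP => // ->; rewrite le_min (ltW xc) andbT.
- exists F2 => // x [/XF[k _ Fkx] /= /negP]; rewrite -leNgt => cx.
  exists k => // j; rewrite mxE.
  by have := Fkx j; case: eqP => // ->; rewrite ge_max cx andbT.
Qed.

Lemma bounded_lebesgue_lty (A : set 'rV[R]_n.+1) :
  bounded_set A -> (lebesgue R n A < +oo)%E.
Proof.
move=> [M [Mreal AM]]; pose B := M + 1.
have AB x : A x -> `|x| <= B by apply: AM; rewrite /B ltrDl.
pose ab : 'rV[R]_n.+1 * 'rV[R]_n.+1 := (const_mx (- B), const_mx B).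
apply: (@le_lt_trans _ _ (box_volume ab)); last by rewrite ltry.
have [i0 wi0] := @box_volume_eq0 R n.
(* Covers are sequences, so the single cube [ab] is padded with a box [i0] of zero volume. *)
have -> : box_volume ab = (\sum_(k <oo) box_volume (if k is 0%N then ab else i0))%E.
  rewrite nneseries_recl//; last by move=> k _; exact: box_volume_ge0.
  by rewrite eseries0 ?adde0// => -[|k].
apply: ereal_inf_lbound; exists (fun k => if k is 0%N then ab else i0) => //.
move=> x Ax; exists 0%N => // i; rewrite !mxE -ler_norml.
apply: le_trans (AB _ Ax); rewrite [leRHS]mx_normrE.
exact: (le_bigmax _ (fun ij => `|x ij.1 ij.2|) (0, i)).
Qed.

End lebesgue_caratheodory.

(** * The Hausdorff measure is a metric outer measure *)

Section hausdorff_caratheodory.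
Context (R : realType) (d k : nat).
Local Open Scope ereal_scope.
Implicit Types A B : set 'rV[R]_d.

Lemma enorm_le_diam A x y : A x -> A y -> (enorm (x - y))%:E <= diam A.
Proof. by move=> Ax Ay; apply: ereal_sup_ubound; right; exists x, y. Qed.

(** A set of diameter at most [delta < e] cannot meet both [A] and [B], and a set of larger diameter
    has infinite weight. Hence a cover of the union splits into a cover of [A] and one of [B]
    without increasing the total weight; [meet C] replaces the sets that miss [C] by the empty set,
    of weight 0. *)
Lemma hausdorff_pre_separated (delta : R) A B (e : R) : (0 < delta < e)%R ->
  (forall x y, A x -> B y -> e <= enorm (x - y))%R ->
  hausdorff_pre k delta A + hausdorff_pre k delta B <=
  hausdorff_pre k delta (A `|` B).
Proof.
move=> /andP[d0 de] sep; rewrite {3}/hausdorff_pre.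
apply: le_ereal_inf_tmp => _ [F ABF <-].
pose meet C j := if `[< F j `&` C !=set0 >] then F j else set0.
have w0 : hausdorff_weight k delta (set0 : set 'rV[R]_d) = 0.
  by rewrite /hausdorff_weight diam0 lee_fin ltW// expeS mul0e mule0.
apply: (@le_trans _ _ (\sum_(j <oo) hausdorff_weight k delta (meet A j) +
    \sum_(j <oo) hausdorff_weight k delta (meet B j))).
  apply: leeD; apply: ereal_inf_lbound.
  - exists (meet A) => // x Ax; have [j _ Fx] := ABF x (or_introl Ax).
    by exists j => //; rewrite /meet; case: asboolP => // -[]; exists x.
  - exists (meet B) => // x Bx; have [j _ Fx] := ABF x (or_intror Bx).
    by exists j => //; rewrite /meet; case: asboolP => // -[]; exists x.
rewrite -nneseriesD; last 2 first.
- by move=> *; exact: hausdorff_weight_ge0.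
- by move=> *; exact: hausdorff_weight_ge0.
apply: lee_nneseries => j *; first by rewrite adde_ge0 ?hausdorff_weight_ge0.
rewrite /meet; case: asboolP => [[x [Fx Ax]]|_]; last first.
  by rewrite w0 add0e; case: asboolP => // _; rewrite w0 hausdorff_weight_ge0.
case: asboolP => [[y [Fy By]]|_]; last by rewrite w0 adde0.
rewrite [leRHS]/hausdorff_weight; case: ifPn => [Fd|_]; last by rewrite leey.
have := le_trans (enorm_le_diam Fx Fy) Fd.
by rewrite lee_fin leNgt (lt_le_trans de (sep _ _ Ax By)).
Qed.

Lemma le_hausdorff_weight (delta eps : R) A : (eps <= delta)%R ->
  hausdorff_weight k delta A <= hausdorff_weight k eps A.
Proof.
move=> ed; rewrite /hausdorff_weight; case: ifPn => [_|].
  by case: ifPn => // _; rewrite leey.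
by case: ifPn => // dA /negP[]; rewrite (le_trans dA)// lee_fin.
Qed.

Lemma le_hausdorff_pre (delta eps : R) A : (eps <= delta)%R ->
  hausdorff_pre k delta A <= hausdorff_pre k eps A.
Proof.
move=> ed; apply: le_ereal_inf_tmp => _ [F AF <-].
apply: (@le_trans _ _ (\sum_(j <oo) hausdorff_weight k delta (F j))).
  by apply: ereal_inf_lbound; exists F.
by apply: lee_nneseries => *; [exact: hausdorff_weight_ge0|exact: le_hausdorff_weight].
Qed.

(** Two scales [d1], [d2] are dominated by a common scale below [e], because the premeasure grows as
    the scale shrinks. The suprema over [d1] and [d2] are then taken one after the other; moving a
    term across the inequality requires it to be finite, which holds unless the right-hand side is
    infinite. *)
Lemma hausdorff_metric A B (e : R) : (0 < e)%R ->
  (forall x y, A x -> B y -> e <= enorm (x - y))%R ->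
  hausdorff k A + hausdorff k B <= hausdorff k (A `|` B).
Proof.
move=> e0 sep.
have key (d1 d2 : R) : (0 < d1)%R -> (0 < d2)%R ->
    hausdorff_pre k d1 A + hausdorff_pre k d2 B <= hausdorff k (A `|` B).
  move=> d10 d20; pose dd := Num.min (Num.min d1 d2) (e / 2)%R.
  have dd0 : (0 < dd)%R by rewrite !lt_min d10 d20 divr_gt0.
  apply: (@le_trans _ _ (hausdorff_pre k dd (A `|` B))); last first.
    by apply: ereal_sup_ubound; exists dd.
  apply: le_trans (hausdorff_pre_separated _ sep); last first.
    rewrite dd0 (@le_lt_trans _ _ (e / 2)%R)//; first by rewrite /dd ge_min lexx orbT.
    by rewrite ltr_pdivrMr// mulr_natr mulr2n ltrDl.
  by apply: leeD; apply: le_hausdorff_pre; rewrite /dd !ge_min lexx ?orbT.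
have ge0 (d1 : R) C : 0 <= hausdorff_pre k d1 C.
  exact/cover_inf_ge0/hausdorff_weight_ge0.
have [->|/eqP ABoo] := eqVneq (hausdorff k (A `|` B)) +oo; first by rewrite leey.
have ABfin : hausdorff k (A `|` B) \is a fin_num.
  by rewrite ge0_fin_numE ?ltey ?hausdorff_ge0//; exact/eqP.
have Bfin (d2 : R) : (0 < d2)%R -> hausdorff_pre k d2 B \is a fin_num.
  move=> d20; rewrite ge0_fin_numE//; apply: le_lt_trans (_ : _ <= _) _; last first.
    by rewrite ltey; exact/eqP/ABoo.
  by apply: le_trans (key 1%R _ ltr01 d20); rewrite leeDr.
have step (d2 : R) : (0 < d2)%R ->
    hausdorff k A + hausdorff_pre k d2 B <= hausdorff k (A `|` B).
  move=> d20; rewrite -leeBrDr ?Bfin//; apply: ge_ereal_sup => _ [d1 /= d10 <-].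
  by rewrite leeBrDr ?Bfin// key.
have Afin : hausdorff k A \is a fin_num.
  rewrite ge0_fin_numE ?hausdorff_ge0//; apply: le_lt_trans (_ : _ <= _) _; last first.
    by rewrite ltey; exact/eqP/ABoo.
  by apply: le_trans (step 1%R ltr01); rewrite leeDl.
rewrite addeC -leeBrDr//; apply: ge_ereal_sup => _ [d2 /= d20 <-].
by rewrite leeBrDr// addeC step.
Qed.

Lemma hausdorff_halfspace i a :
  (@hausdorff R d k).-caratheodory [set x : 'rV[R]_d | (x 0 i < a)%R].
Proof. by apply: metric_halfspace_caratheodory => A B e; exact: hausdorff_metric. Qed.

End hausdorff_caratheodory.

(** * Lebesgue norms *)

Section hoelder_generalized.
Context d (T : measurableType d) (R : realType) (mu : {measure set T -> \bar R}).
Implicit Types (f g : T -> R) (a b c p r : R).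
Local Open Scope ereal_scope.

Lemma measurable_abs_powR f p : measurable_fun setT f ->
  measurable_fun setT (fun x => `|f x| `^ p)%R.
Proof.
move=> mf; apply: (@measurableT_comp _ _ _ _ _ _ (@powR R ^~ p)) => //.
exact: measurableT_comp.
Qed.

Lemma Lnorm_abs_powR f a c : (0 < a)%R -> (0 < c)%R ->
  'N[mu]_(a / c)%:E [EFin \o (fun x => `|f x| `^ c)%R] = 'N[mu]_a%:E [EFin \o f] `^ c.
Proof.
move=> a0 c0; rewrite unlock invf_div [(c / a)%R]mulrC -poweRrM; congr (_ `^ _).
apply: eq_integral => x _ /=; rewrite ger0_norm ?powR_ge0// -powRrM.
by rewrite mulrCA divff ?gt_eqF// mulr1.
Qed.

(** The classical inequality for [|f|^c] and [|g|^c], with the conjugate exponents [a / c] and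
    [b / c], followed by a [c]-th root. *)
Lemma hoelder_gen f g a b c :
  measurable_fun setT f -> measurable_fun setT g ->
  (0 < a)%R -> (0 < b)%R -> (0 < c)%R -> (a^-1 + b^-1 = c^-1)%R ->
  'N[mu]_c%:E [EFin \o (f \* g)%R] <= 'N[mu]_a%:E [EFin \o f] * 'N[mu]_b%:E [EFin \o g].
Proof.
move=> mf mg a0 b0 c0 abc.
have H : 'N[mu]_c%:E [EFin \o (f \* g)%R] `^ c <=
    ('N[mu]_a%:E [EFin \o f] * 'N[mu]_b%:E [EFin \o g]) `^ c.
  rewrite poweRM ?Lnorm_ge0// -(Lnorm_abs_powR f)// -(Lnorm_abs_powR g)//.
  have ac0 : (0 < a / c)%R by rewrite divr_gt0.
  have bc0 : (0 < b / c)%R by rewrite divr_gt0.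
  have acbc : ((a / c)^-1 + (b / c)^-1 = 1)%R.
    by rewrite !invf_div -mulrDr abc divff ?gt_eqF.
  apply: le_trans (hoelder mu (measurable_abs_powR _ mf) (measurable_abs_powR _ mg)
    ac0 bc0 acbc).
  rewrite poweR_Lnorm ?gt_eqF// Lnorm1 le_eqVlt; apply/orP; left; apply/eqP.
  apply: eq_integral => x _ /=.
  by rewrite !normrM powRM// !(ger0_norm (powR_ge0 _ _)).
have c0' : (0 <= c^-1)%R by rewrite invr_ge0 ltW.
have := gt0_ler_poweR c0' _ _ H.
rewrite !in_itv/= !leey !andbT !poweR_ge0 -!poweRrM divff ?gt_eqF//.
by rewrite !poweRe1 ?mule_ge0 ?Lnorm_ge0//; apply.
Qed.

Lemma le_Lnorm f g p : (0 < p)%R -> measurable_fun setT f -> measurable_fun setT g ->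
  {ae mu, forall x, (`|f x| <= `|g x|)%R} ->
  'N[mu]_p%:E [EFin \o f] <= 'N[mu]_p%:E [EFin \o g].
Proof.
move=> p0 mf mg fg; rewrite unlock.
apply: gt0_ler_poweR; first by rewrite invr_ge0 ltW.
- by rewrite in_itv/= leey andbT integral_ge0// => x _; rewrite poweR_ge0.
- by rewrite in_itv/= leey andbT integral_ge0// => x _; rewrite poweR_ge0.
apply: ae_ge0_le_integral => //=.
- exact/measurable_EFinP/measurable_abs_powR.
- exact/measurable_EFinP/measurable_abs_powR.
apply: filterS fg => x fgx _; rewrite lee_fin.
by apply: ge0_ler_powR; rewrite ?nnegrE ?(ltW p0).
Qed.

Lemma minkowskiB_EFin f g p : (1 <= p)%R ->
  measurable_fun setT f -> measurable_fun setT g ->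
  'N[mu]_p%:E [EFin \o (f \- g)%R] <= 'N[mu]_p%:E [EFin \o f] + 'N[mu]_p%:E [EFin \o g].
Proof.
move=> p1 mf mg; have <- : 'N[mu]_p%:E [EFin \o (-%R \o g)] = 'N[mu]_p%:E [EFin \o g].
  by rewrite -[RHS]oppe_Lnorm.
by apply: (minkowski_EFin _ mf _ p1); exact: measurableT_comp.
Qed.

Lemma ae_bounded_Lnorm_lty (D : set T) f p r : measurable D -> mu D < +oo ->
  (0 < p)%R -> measurable_fun setT (f \_ D) ->
  {ae mu, forall x, D x -> (`|f x| <= r)%R} -> 'N[mu]_p%:E [EFin \o (f \_ D)] < +oo.
Proof.
move=> mD muD p0 mf fr; rewrite unlock poweR_lty//.
apply: (@le_lt_trans _ _ (\int[mu]_x ((cst (`|r| `^ p)%:E) \_ D) x)).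
  apply: ae_ge0_le_integral => //=.
  - exact/measurable_EFinP/measurable_abs_powR.
  - by move=> x _; rewrite patchE; case: ifP => // _; rewrite lee_fin powR_ge0.
  - by apply/(measurable_restrictT _ mD).
  apply: filterS fr => x fx _; rewrite !patchE.
  case: ifPn => [/set_mem/fx xr|_]; last by rewrite normr0 powR0 ?gt_eqF.
  rewrite lee_fin ge0_ler_powR ?nnegrE ?(ltW p0)//.
  by rewrite (le_trans xr)// ler_norm.
by rewrite -integral_mkcond integral_cst// lte_mul_pinfty ?lee_fin ?powR_ge0.
Qed.

Lemma Lfun1_restrict_integrable (D : set T) f : measurable D ->
  f \_ D \in Lfun mu 1 -> mu.-integrable D (EFin \o f).
Proof.
move=> mD Lf; apply/(integrable_mkcond _ mD).
by rewrite restrict_EFin; apply/Lfun1_integrable.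
Qed.

Lemma le_Rintegral_Lnorm1 (D : set T) f : measurable D ->
  f \_ D \in Lfun mu 1 ->
  `|\int[mu]_(x in D) f x|%R%:E <= 'N[mu]_1 [EFin \o (f \_ D)].
Proof.
move=> mD Lf; have If := Lfun1_restrict_integrable mD Lf.
rewrite EFin_normr_Rintegral// Lnorm1 integral_mkcond restrict_EFin.
apply: le_abse_integral => //.
by case/(integrable_mkcond _ mD)/integrableP : If; rewrite restrict_EFin.
Qed.

End hoelder_generalized.

(** Measurability of the extension by zero to the whole space, the form in which [Lp] contains
    it. *)
Notation leb_measurable Omega f := (measurable_fun setT
  (f \_ Omega : caratheodory_type (@lebesgue_outer _ _) -> _)).

(** * Lebesgue spaces on a bounded open set *)

Section restricted_Lebesgue.
Context (R : realType) (n : nat) (Omega : set 'rV[R]_n.+2).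
Hypotheses (openO : open Omega) (bndO : bounded_set Omega).
Notation point := 'rV[R]_n.+2.
Notation mu := (leb R n).
Notation cpoint := (caratheodory_type (@lebesgue_outer R n.+1)).
Implicit Types (f g u w : point -> R) (y v : point -> point) (p q a b c : R).

Lemma measurable_Omega : measurable (Omega : set cpoint).
Proof. by apply: open_caratheodory => // i a; exact: lebesgue_halfspace. Qed.

Lemma leb_Omega_lty : (mu Omega < +oo)%E.
Proof. exact: bounded_lebesgue_lty. Qed.

Lemma restrictRE f x : (f \_ Omega) x = if x \in Omega then f x else 0.
Proof. by rewrite patchE. Qed.

Lemma restrictRD f g : (fun x => f x + g x) \_ Omega = f \_ Omega \+ g \_ Omega.
Proof. by apply/funext => x; rewrite /= !restrictRE; case: ifP; rewrite ?addr0. Qed.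

Lemma restrictRM f g : (fun x => f x * g x) \_ Omega = f \_ Omega \* g \_ Omega.
Proof. by apply/funext => x; rewrite /= !restrictRE; case: ifP; rewrite ?mulr0. Qed.

Lemma LpP p f : Lp Omega p f <-> leb_measurable Omega f /\ (Lpnorm Omega p f < +oo)%E.
Proof.
rewrite /Lp /= inE; split=> [/andP[]|[mf nf]]; first by rewrite !inE.
by apply/andP; split; rewrite inE.
Qed.

Lemma Lp_measurable p f : Lp Omega p f -> leb_measurable Omega f.
Proof. by move=> /LpP[]. Qed.

Lemma Lp_lty p f : Lp Omega p f -> (Lpnorm Omega p f < +oo)%E.
Proof. by move=> /LpP[]. Qed.

Lemma Lpnorm_ge0 p f : (0 <= Lpnorm Omega p f)%E.
Proof. exact: Lnorm_ge0. Qed.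
Hint Resolve Lpnorm_ge0 : core.

Lemma Lp_fin p f : Lp Omega p f -> Lpnorm Omega p f \is a fin_num.
Proof. by move=> /Lp_lty ?; rewrite ge0_fin_numE. Qed.

Lemma leb_measurableD f g : leb_measurable Omega f -> leb_measurable Omega g ->
  leb_measurable Omega (fun x => f x + g x).
Proof. by rewrite restrictRD => *; exact: measurable_funD. Qed.

Lemma leb_measurableM f g : leb_measurable Omega f -> leb_measurable Omega g ->
  leb_measurable Omega (fun x => f x * g x).
Proof. by rewrite restrictRM => *; exact: measurable_funM. Qed.

Lemma leb_measurable_comp f (h : R -> R) : measurable_fun setT h -> h 0 = 0 ->
  leb_measurable Omega f ->
  leb_measurable Omega (fun x => h (f x)).
Proof.
move=> mh h0 mf; rewrite (_ : _ \_ _ = h \o f \_ Omega).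
  exact: (measurableT_comp mh mf).
by apply/funext => x; rewrite /= !restrictRE; case: ifP.
Qed.

Lemma leb_measurable_cst (r : R) : leb_measurable Omega (cst r).
Proof. by apply/(measurable_restrictT _ measurable_Omega). Qed.

Lemma leb_measurable_dotp y v : (forall i, leb_measurable Omega (fun x => y x 0 i)) ->
  (forall i, leb_measurable Omega (fun x => v x 0 i)) ->
  leb_measurable Omega (fun x => dotp (y x) (v x)).
Proof.
move=> my mv; rewrite /dotp.
have -> : (fun x => \sum_i y x 0 i * v x 0 i) =
    \sum_i (fun x => y x 0 i * v x 0 i) by apply/funext => x; rewrite fct_sumE.
elim/big_ind : _ => [|f g mf mg|i _].
- exact: leb_measurable_cst.
- exact: leb_measurableD.
- exact: leb_measurableM.
Qed.

Lemma leb_measurable_enorm y : (forall i, leb_measurable Omega (fun x => y x 0 i)) ->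
  leb_measurable Omega (fun x => enorm (y x)).
Proof.
move=> my; apply: (@leb_measurable_comp (fun x => dotp (y x) (y x)) Num.sqrt).
- apply: continuous_measurable_fun; exact: sqrt_continuous.
- exact: sqrtr0.
- exact: leb_measurable_dotp.
Qed.

Lemma le_Lpnorm p f g : 0 < p -> leb_measurable Omega f -> leb_measurable Omega g ->
  (forall x, Omega x -> `|f x| <= `|g x|) -> (Lpnorm Omega p f <= Lpnorm Omega p g)%E.
Proof.
move=> p0 mf mg fg; apply: le_Lnorm => //; apply: aeW => x /=.
by rewrite !restrictRE; case: ifPn => // /set_mem/fg.
Qed.

Lemma eq_Lpnorm p f g : (forall x, `|f x| = `|g x|) ->
  Lpnorm Omega p f = Lpnorm Omega p g.
Proof.
move=> fg; rewrite /Lpnorm -[LHS]Lnorm_abse -[RHS]Lnorm_abse; apply: eq_Lnorm => x /=.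
by rewrite !restrictRE; case: ifP => // _; rewrite fg.
Qed.

Lemma Lp_le p f g : 0 < p -> leb_measurable Omega f -> Lp Omega p g ->
  (forall x, Omega x -> `|f x| <= `|g x|) -> Lp Omega p f.
Proof.
move=> p0 mf /LpP[mg ng] fg; apply/LpP; split=> //.
exact: le_lt_trans (le_Lpnorm p0 mf mg fg) ng.
Qed.

Lemma LpnormD p f g : 1 <= p -> leb_measurable Omega f -> leb_measurable Omega g ->
  (Lpnorm Omega p (fun x => (f x + g x)%R) <= Lpnorm Omega p f + Lpnorm Omega p g)%E.
Proof. by move=> p1 mf mg; rewrite {1}/Lpnorm restrictRD; exact: minkowski_EFin. Qed.

Lemma LpD p f g : 1 <= p -> Lp Omega p f -> Lp Omega p g ->
  Lp Omega p (fun x => f x + g x).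
Proof.
move=> p1 /LpP[mf nf] /LpP[mg ng]; apply/LpP; split; first exact: leb_measurableD.
by apply: le_lt_trans (LpnormD p1 mf mg) _; rewrite lte_add_pinfty.
Qed.

Lemma leb_measurableN f : leb_measurable Omega f -> leb_measurable Omega (fun x => - f x).
Proof. by move=> mf; apply: (@leb_measurable_comp f -%R) => //; exact: oppr0. Qed.

Lemma LpN p f : Lp Omega p f -> Lp Omega p (fun x => - f x).
Proof.
move=> /LpP[mf nf]; apply/LpP; split; first exact: leb_measurableN.
by rewrite (@eq_Lpnorm _ _ f)// => x; rewrite normrN.
Qed.

Lemma LpB p f g : 1 <= p -> Lp Omega p f -> Lp Omega p g ->
  Lp Omega p (fun x => f x - g x).
Proof. by move=> p1 Lf /LpN Lg; exact: LpD. Qed.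

Lemma Lp0 p : 0 < p -> Lp Omega p (cst 0).
Proof.
move=> p0; apply/LpP; split; first exact: leb_measurable_cst.
rewrite /Lpnorm (_ : _ \o _ = cst 0%E) ?Lnorm0 ?gt_eqF//.
by apply/funext => x; rewrite /= restrictRE; case: ifP.
Qed.

Lemma Lp_sum p (I : Type) (r : seq I) (F : I -> point -> R) : 1 <= p ->
  (forall i, Lp Omega p (F i)) -> Lp Omega p (\sum_(i <- r) F i).
Proof.
move=> p1 LF; elim/big_ind : _ => [|f g Lf Lg|i _]; [|exact: LpD|exact: LF].
by apply: Lp0; apply: lt_le_trans p1.
Qed.

Lemma LpM a b c f g : 0 < a -> 0 < b -> 0 < c -> a^-1 + b^-1 = c^-1 ->
  Lp Omega a f -> Lp Omega b g -> Lp Omega c (fun x => f x * g x).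
Proof.
move=> a0 b0 c0 abc /LpP[mf nf] /LpP[mg ng]; apply/LpP; split; first exact: leb_measurableM.
rewrite /Lpnorm restrictRM; apply: le_lt_trans (hoelder_gen _ mf mg a0 b0 c0 abc) _.
by rewrite lte_mul_pinfty ?Lnorm_ge0// ge0_fin_numE ?Lnorm_ge0.
Qed.

Lemma LpnormM a b c f g : 0 < a -> 0 < b -> 0 < c -> a^-1 + b^-1 = c^-1 ->
  leb_measurable Omega f -> leb_measurable Omega g ->
  (Lpnorm Omega c (fun x => (f x * g x)%R) <= Lpnorm Omega a f * Lpnorm Omega b g)%E.
Proof.
move=> a0 b0 c0 abc mf mg; rewrite {1}/Lpnorm restrictRM.
exact: hoelder_gen.
Qed.

Lemma Lp_ae_bounded p f r : 0 < p -> leb_measurable Omega f ->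
  {ae mu, forall x, Omega x -> `|f x| <= r} -> Lp Omega p f.
Proof.
move=> p0 mf fr; apply/LpP; split=> //.
exact: (ae_bounded_Lnorm_lty measurable_Omega leb_Omega_lty p0 mf fr).
Qed.

Lemma Lp_cst p r : 0 < p -> Lp Omega p (cst r).
Proof.
move=> p0; apply: (@Lp_ae_bounded _ _ `|r|) => //; first exact: leb_measurable_cst.
exact: aeW.
Qed.

(** Hoelder's inequality against the constant 1, with 1/p = 1/r + 1/q. The constant is the L^r norm
    of 1, finite because [Omega] is bounded, and it does not depend on [f]. *)
Lemma Lpnorm_weaken p q : 0 < p < q ->
  exists2 K, 0 <= K & forall f, leb_measurable Omega f ->
    (Lpnorm Omega p f <= K%:E * Lpnorm Omega q f)%E.
Proof.
move=> /andP[p0 pq]; have q0 : 0 < q := lt_trans p0 pq.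
pose r := (p^-1 - q^-1)^-1.
have r0 : 0 < r by rewrite invr_gt0 subr_gt0 ltf_pV2.
exists (fine (Lpnorm Omega r (cst 1))); first by rewrite fine_ge0.
move=> f mf; rewrite fineK; last exact/Lp_fin/Lp_cst.
rewrite (@eq_Lpnorm p f (fun x => cst 1 x * f x)); last by move=> x; rewrite mul1r.
apply: LpnormM => //; last exact: leb_measurable_cst.
by rewrite invrK subrK.
Qed.

Lemma Lp_weaken p q f : 0 < p < q -> Lp Omega q f -> Lp Omega p f.
Proof.
move=> /Lpnorm_weaken[K K0 pq] /LpP[mf nf]; apply/LpP; split=> //.
by apply: le_lt_trans (pq _ mf) _; rewrite lte_mul_pinfty.
Qed.

(** The Euclidean norm is at most the sum of the absolute values of the coordinates, and L^p is
    closed under finite sums. *)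
Lemma Lp_enorm p y : 1 <= p -> (forall i, Lp Omega p (fun x => y x 0 i)) ->
  Lp Omega p (fun x => enorm (y x)).
Proof.
move=> p1 Ly; have p0 : 0 < p by apply: lt_le_trans p1.
have Labs i : Lp Omega p (fun x => `|y x 0 i|).
  apply: Lp_le (Ly i) _ => //; last by move=> x; rewrite normr_id.
  by apply: (@leb_measurable_comp _ (@Num.norm _ R)); rewrite ?normr0//;
    exact: Lp_measurable (Ly i).
apply: Lp_le (Lp_sum (index_enum 'I_n.+2) p1 Labs) _ => //.
  by apply: leb_measurable_enorm => i; exact: Lp_measurable (Ly i).
move=> x _; rewrite fct_sumE ger0_norm ?enorm_ge0// ger0_norm ?sumr_ge0//.
rewrite -ler_sqr ?nnegrE ?enorm_ge0 ?sumr_ge0// sqr_enorm /dotp.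
rewrite [leRHS]expr2 mulr_suml ler_sum// => i _.
rewrite -expr2 -real_normK ?num_real// expr2 ler_wpM2l//.
by rewrite (bigD1 i)//= lerDl sumr_ge0.
Qed.

Lemma Lp_dotp a b c y v : 0 < a -> 0 < b -> 0 < c -> 1 <= a -> 1 <= b -> a^-1 + b^-1 = c^-1 ->
  (forall i, Lp Omega a (fun x => y x 0 i)) ->
  (forall i, Lp Omega b (fun x => v x 0 i)) ->
  Lp Omega c (fun x => dotp (y x) (v x)).
Proof.
move=> a0 b0 c0 a1 b1 abc Ly Lv.
apply: Lp_le (LpM a0 b0 c0 abc (Lp_enorm a1 Ly) (Lp_enorm b1 Lv)) _ => //.
  by apply: leb_measurable_dotp => i; exact: Lp_measurable.
move=> x _; apply: le_trans (CauchySchwarz_dotp _ _) _; exact: ler_norm.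
Qed.

Lemma Lpnorm_dotp a b c y v : 0 < a -> 0 < b -> 0 < c -> a^-1 + b^-1 = c^-1 ->
  (forall i, leb_measurable Omega (fun x => y x 0 i)) ->
  (forall i, leb_measurable Omega (fun x => v x 0 i)) ->
  (Lpnorm Omega c (fun x => dotp (y x) (v x)) <=
   Lpnorm Omega a (fun x => enorm (y x)) * Lpnorm Omega b (fun x => enorm (v x)))%E.
Proof.
move=> a0 b0 c0 abc my mv.
apply: le_trans (LpnormM a0 b0 c0 abc (leb_measurable_enorm my) (leb_measurable_enorm mv)).
apply: le_Lpnorm => //; first exact: leb_measurable_dotp.
  by apply: leb_measurableM; exact: leb_measurable_enorm.
move=> x _; apply: le_trans (CauchySchwarz_dotp _ _) _; exact: ler_norm.
Qed.

Lemma Lp1_integrable f : Lp Omega 1 f ->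
  mu.-integrable (Omega : set cpoint) (EFin \o f).
Proof. exact: (Lfun1_restrict_integrable measurable_Omega). Qed.

Lemma le_Rintegral_Lpnorm1 f : Lp Omega 1 f ->
  (`|\int[mu]_(x in Omega) f x|%:E <= Lpnorm Omega 1 f)%E.
Proof. exact: (le_Rintegral_Lnorm1 measurable_Omega). Qed.

End restricted_Lebesgue.

(** * Sobolev functions and their traces *)

Section classical_functions.
Context (R : realType) (n : nat).
Notation point := 'rV[R]_n.+2.
Implicit Types (phi psi : point -> R).

Lemma partialB i phi psi : (forall x, derivable phi x (evec R i)) ->
  (forall x, derivable psi x (evec R i)) ->
  partial i (phi - psi) = partial i phi - partial i psi.
Proof. by move=> dphi dpsi; apply/funext => x; rewrite /partial deriveB. Qed.

Lemma CkB k phi psi : Ck k phi -> Ck k psi -> Ck k (phi - psi).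
Proof.
elim: k phi psi => [|k IH] phi psi /= [cphi dphi] [cpsi dpsi].
  by split=> // x; apply: continuousB; [exact: cphi|exact: cpsi].
split=> [x|i]; first by apply: continuousB; [exact: cphi|exact: cpsi].
have [dphii Ckphi] := dphi i; have [dpsii Ckpsi] := dpsi i.
split=> [x|]; first by apply: derivableB; [exact: dphii|exact: dpsii].
by rewrite (partialB dphii dpsii); exact: IH.
Qed.

Lemma smoothB phi psi : smooth phi -> smooth psi -> smooth (phi - psi).
Proof. by move=> sphi spsi k; apply: CkB. Qed.

Lemma smooth_continuous phi : smooth phi -> continuous phi.
Proof. by move=> /(_ 0%N)[]. Qed.

Lemma smooth_derivable phi i x : smooth phi -> derivable phi x (evec R i).
Proof. by move=> /(_ 1%N)[_ /(_ i)[]]. Qed.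

Lemma smooth_partial_continuous phi i : smooth phi -> continuous (partial i phi).
Proof. by move=> /(_ 1%N)[_ /(_ i)[_ []]]. Qed.

Lemma classicalB phi psi : smooth phi -> smooth psi ->
  classical (phi - psi) = classical phi - classical psi :> sob R n.
Proof.
move=> sphi spsi; congr pair; apply/funext => x; apply/rowP => i.
rewrite !mxE partialB// => z; exact: smooth_derivable.
Qed.

Lemma smooth0 : smooth (0 : point -> R).
Proof.
elim=> [|k IH]; split=> //; try exact: cst_continuous.
move=> i; split=> [x|]; first exact: derivable_cst.
by rewrite (_ : partial i 0 = 0)//; apply/funext => x; exact: derive_cst.
Qed.

Lemma classical0 : classical 0 = 0 :> sob R n.
Proof.
congr pair; apply/funext => x; apply/rowP => i; rewrite !mxE.
exact: derive_cst.
Qed.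

End classical_functions.

Lemma squeezeD_cvg0 (R : realType) (u a b : nat -> \bar R) :
  (forall k, 0 <= u k <= a k + b k)%E ->
  a k @[k --> \oo] --> 0%E -> b k @[k --> \oo] --> 0%E -> u k @[k --> \oo] --> 0%E.
Proof.
move=> uab a0 b0.
apply: (@squeeze_cvge _ _ _ _ (cst 0%E) _ (fun k => a k + b k)%E); first exact: nearW.
  exact: cvg_cst.
by rewrite -[0%E]adde0; apply: cvgeD.
Qed.

(** * Differences of Sobolev functions and of their traces *)

Section sobolev_differences.
Context (R : realType) (n : nat) (Omega : set 'rV[R]_n.+2).
Hypotheses (openO : open Omega) (bndO : bounded_set Omega).
Notation point := 'rV[R]_n.+2.
Notation mu := (leb R n).
Notation hmu := (surf R n).
Implicit Types (p : R) (y z : sob R n) (f g h phi : point -> R).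

Lemma continuous_leb_measurable f : continuous f -> leb_measurable Omega f.
Proof.
move=> cf; apply/(measurable_restrictT _ (measurable_Omega openO)).
apply: measurable_funTS.
by apply: continuous_caratheodory => // i a; exact: lebesgue_halfspace.
Qed.

(** [f] is continuous on the whole space and [Omega] lies in a compact ball, on which [f] is
    bounded. *)
Lemma continuous_Lp p f : 0 < p -> continuous f -> Lp Omega p f.
Proof.
move=> p0 cf; have [M [Mreal OM]] := bndO.
pose K : set point := [set x | `|x| <= M + 1].
have cK : compact K.
  apply: bounded_closed_compact.
    exists (M + 1); split; first exact: num_real.
    by move=> r /ltW Mr x /le_trans; apply.
  apply: (@closed_comp _ _ (fun x : point => `|x|) [set r | r <= M + 1]).
    by move=> x _; exact: norm_continuous.
  exact: closed_le.
have [B [Breal fB]] : bounded_set (f @` K).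
  apply: compact_bounded; apply: continuous_compact => //.
  exact: continuous_subspaceT.
apply: (@Lp_ae_bounded _ _ _ openO bndO _ _ (B + 1)) => //.
  exact: continuous_leb_measurable.
apply: (@aeW _ _ _ mu) => x Ox; apply: (fB (B + 1)); first by rewrite ltrDl.
by exists x => //; apply: OM => //; rewrite ltrDl.
Qed.

(** All that Minkowski's inequality asks for. Smooth approximants have this property by continuity,
    so that no integration by parts is needed to place them in W^{1,p}. *)
Definition sob_measurable y :=
  leb_measurable Omega y.1 /\ forall i, leb_measurable Omega (fun x => grad y x 0 i).

Lemma W1_measurable p y : W1 Omega p y -> sob_measurable y.
Proof.
move=> [Ly Lgy _]; split; first exact: Lp_measurable Ly.
by move=> i; exact: Lp_measurable (Lgy i).
Qed.

Lemma classical_measurable phi : smooth phi -> sob_measurable (classical phi).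
Proof.
move=> sphi; split; first exact: (continuous_leb_measurable (smooth_continuous sphi)).
move=> i; have -> : (fun x => grad (classical phi) x 0 i) = partial i phi.
  by apply/funext => x; rewrite /grad /= mxE.
exact: (continuous_leb_measurable (smooth_partial_continuous sphi)).
Qed.

Lemma sob_measurableB y z : sob_measurable y -> sob_measurable z ->
  sob_measurable (y - z).
Proof.
move=> [my mgy] [mz mgz]; split.
  exact: leb_measurableD my (leb_measurableN mz).
move=> i; have -> : (fun x => grad (y - z) x 0 i) = fun x => grad y x 0 i + - grad z x 0 i.
  by apply/funext => x; rewrite /grad /= !mxE.
exact: leb_measurableD (mgy i) (leb_measurableN (mgz i)).
Qed.

Lemma W1normB p y z : 1 <= p -> sob_measurable y -> sob_measurable z ->
  (W1norm Omega p (y - z)%R <= W1norm Omega p y + W1norm Omega p z)%E.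
Proof.
move=> p1 [my mgy] [mz mgz]; rewrite /W1norm addeACA.
have p0 : 0 < p by apply: lt_le_trans p1.
apply: leeD.
  rewrite -(@eq_Lpnorm _ _ _ p (fun x => - z.1 x) z.1); last by move=> x; rewrite normrN.
  apply: LpnormD => //; exact: leb_measurableN.
have [_ mgyz] := sob_measurableB (conj my mgy) (conj mz mgz).
apply: le_trans (LpnormD p1 (leb_measurable_enorm openO mgy) (leb_measurable_enorm openO mgz)).
apply: le_Lpnorm => //.
- exact: (leb_measurable_enorm openO mgyz).
- by apply: leb_measurableD; exact: leb_measurable_enorm.
- move=> x _; rewrite !ger0_norm ?addr_ge0 ?enorm_ge0//.
  rewrite (_ : grad (y - z) x = grad y x + (- grad z x))//.
  apply: le_trans (enormD _ _) _; rewrite lerD2l.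
  by rewrite /enorm dotpNl dotpC dotpNl opprK.
Qed.

(** Splitting the integrals requires each product to be integrable: test functions and their partial
    derivatives are continuous, hence in L^2 of the bounded set [Omega], and a product of two L^2
    functions is in L^1. *)
Lemma weak_gradientB y z : W1 Omega 2 y -> W1 Omega 2 z ->
  weak_gradient Omega (y - z).
Proof.
move=> [Ly Lgy wy] [Lz Lgz wz] phi sphi cphi i.
have L2phi : Lp Omega 2 phi by apply: continuous_Lp => //; exact: smooth_continuous.
have L2dphi : Lp Omega 2 (partial i phi).
  by apply: continuous_Lp => //; exact: smooth_partial_continuous.
have L2M f g : Lp Omega 2 f -> Lp Omega 2 g ->
    mu.-integrable (Omega : set (caratheodory_type (@lebesgue_outer R n.+1)))
      (EFin \o (fun x => f x * g x)).
  move=> Lf Lg; apply: Lp1_integrable => //.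
  by apply: (LpM _ _ _ _ Lf Lg) => //; rewrite invr1 [RHS]splitr !div1r.
have mO := measurable_Omega openO.
have -> : \int[mu]_(x in Omega) ((y - z).1 x * partial i phi x) =
    \int[mu]_(x in Omega) (y.1 x * partial i phi x) -
    \int[mu]_(x in Omega) (z.1 x * partial i phi x).
  rewrite -(RintegralB mO (L2M _ _ Ly L2dphi) (L2M _ _ Lz L2dphi)).
  by apply: eq_Rintegral => x _; rewrite -mulrBl.
have -> : \int[mu]_(x in Omega) (grad (y - z) x 0 i * phi x) =
    \int[mu]_(x in Omega) (grad y x 0 i * phi x) -
    \int[mu]_(x in Omega) (grad z x 0 i * phi x).
  rewrite -(RintegralB mO (L2M _ _ (Lgy i) L2phi) (L2M _ _ (Lgz i) L2phi)).
  by apply: eq_Rintegral => x _; rewrite -mulrBl /grad /= !mxE.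
by rewrite wy// wz// opprB opprK addrC.
Qed.

Lemma W1B y z : W1 Omega 2 y -> W1 Omega 2 z -> W1 Omega 2 (y - z).
Proof.
move=> Wy Wz; have [Ly Lgy _] := Wy; have [Lz Lgz _] := Wz; split.
- by apply: LpB => //; rewrite ler1n.
- move=> i; have -> : (fun x => grad (y - z) x 0 i) = fun x => grad y x 0 i - grad z x 0 i.
    by apply/funext => x; rewrite /grad /= !mxE.
  by apply: LpB => //; rewrite ler1n.
- exact: weak_gradientB.
Qed.

Lemma measurable_boundary :
  measurable (boundary Omega : set (caratheodory_type (@hausdorff R n.+2 n))).
Proof.
have mopen U : open U -> measurable (U : set (caratheodory_type (@hausdorff R n.+2 n))).
  by move=> oU; apply: open_caratheodory => // i a; exact: hausdorff_halfspace.
apply: measurableD; last exact/mopen/open_interior.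
by rewrite -[X in measurable X]setCK; apply/measurableC/mopen/closed_openC/closed_closure.
Qed.

Lemma LpsurfP p g : Lpsurf (boundary Omega) p g <->
  measurable_fun setT (g \_ (boundary Omega) : caratheodory_type (@hausdorff R n.+2 n) -> R) /\
  (Lpsurfnorm (boundary Omega) p g < +oo)%E.
Proof.
rewrite /Lpsurf /= inE; split=> [/andP[]|[mg ng]]; first by rewrite !inE.
by apply/andP; split; rewrite inE.
Qed.

Lemma LpsurfnormB p f g : 1 <= p ->
  measurable_fun setT (f \_ (boundary Omega) : caratheodory_type (@hausdorff R n.+2 n) -> R) ->
  measurable_fun setT (g \_ (boundary Omega) : caratheodory_type (@hausdorff R n.+2 n) -> R) ->
  (Lpsurfnorm (boundary Omega) p (f - g)%R <=
   Lpsurfnorm (boundary Omega) p f + Lpsurfnorm (boundary Omega) p g)%E.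
Proof.
move=> p1 mf mg; rewrite {1}/Lpsurfnorm.
have -> : (f - g) \_ (boundary Omega) = f \_ (boundary Omega) \- g \_ (boundary Omega).
  by apply/funext => x; rewrite /= !patchE; case: ifP => // _; rewrite subr0.
exact: (minkowskiB_EFin _ p1 mf mg).
Qed.

Lemma LpsurfB p f g : 1 <= p -> Lpsurf (boundary Omega) p f ->
  Lpsurf (boundary Omega) p g -> Lpsurf (boundary Omega) p (f - g).
Proof.
move=> p1 /LpsurfP[mf nf] /LpsurfP[mg ng]; apply/LpsurfP; split.
  have -> : (f - g) \_ (boundary Omega) = f \_ (boundary Omega) \- g \_ (boundary Omega).
    by apply/funext => x; rewrite /= !patchE; case: ifP => // _; rewrite subr0.
  exact: measurable_funB.
by apply: le_lt_trans (LpsurfnormB p1 mf mg) _; rewrite lte_add_pinfty.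
Qed.

(** The functions [phi k - psi k] approximate the difference, by Minkowski's inequality in [Omega]
    and on the boundary. The latter uses that continuous functions are measurable for the surface
    measure. *)
Lemma has_traceB p y z f g : 1 <= p -> sob_measurable y -> sob_measurable z ->
  has_trace Omega p y f -> has_trace Omega p z g ->
  has_trace Omega p (y - z) (f - g).
Proof.
move=> p1 my mz [Lf [phi [sphi yphi fphi]]] [Lg [psi [spsi zpsi gpsi]]].
have mrestrict h : continuous h -> measurable_fun setT
    (h \_ (boundary Omega) : caratheodory_type (@hausdorff R n.+2 n) -> R).
  move=> ch; apply/(measurable_restrictT _ measurable_boundary).
  apply: measurable_funTS.
  by apply: continuous_caratheodory => // i a; exact: hausdorff_halfspace.
have mB h1 h2 : continuous h1 -> Lpsurf (boundary Omega) p h2 -> measurable_fun setT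
    ((h1 - h2) \_ (boundary Omega) : caratheodory_type (@hausdorff R n.+2 n) -> R).
  move=> /mrestrict mh1 /LpsurfP[mh2 _].
  have -> : (h1 - h2) \_ (boundary Omega) = h1 \_ (boundary Omega) \- h2 \_ (boundary Omega).
    by apply/funext => x; rewrite /= !patchE; case: ifP => // _; rewrite subr0.
  exact: measurable_funB.
split; first exact: LpsurfB.
exists (fun k => phi k - psi k); split.
- by move=> k; exact: smoothB.
- apply: squeezeD_cvg0 yphi zpsi => k; apply/andP; split.
    by rewrite /W1norm adde_ge0 ?Lpnorm_ge0.
  have -> : y - z - classical (phi k - psi k) =
      (y - classical (phi k)) - (z - classical (psi k)).
    by rewrite classicalB// !opprB addrACA [RHS]addrACA; congr (_ + _); exact: addrC.
  exact: (W1normB p1 (sob_measurableB my (classical_measurable (sphi k)))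
    (sob_measurableB mz (classical_measurable (spsi k)))).
- apply: squeezeD_cvg0 fphi gpsi => k; apply/andP; split; first exact: Lnorm_ge0.
  have -> : phi k - psi k - (f - g) = (phi k - f) - (psi k - g).
    by rewrite !opprB addrACA [RHS]addrACA; congr (_ + _); exact: addrC.
  exact: (LpsurfnormB p1 (mB _ _ (smooth_continuous (sphi k)) Lf)
    (mB _ _ (smooth_continuous (spsi k)) Lg)).
Qed.

Lemma trace_eq_onB p (S : set point) y z f g : 1 <= p ->
  sob_measurable y -> sob_measurable z ->
  trace_eq_on Omega p S y f -> trace_eq_on Omega p S z g ->
  trace_eq_on Omega p S (y - z) (f - g).
Proof.
move=> p1 my mz [ty tyE yf] [tz tzE zg]; exists (ty - tz); first exact: has_traceB.
have FF := ae_filter_ringOfSetsType hmu.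
by apply: (@filterS2 _ _ FF _ _ _ _ yf zg) => x /= ytx ztx Sx; rewrite !fctE ytx ?ztx.
Qed.

Lemma W1DB (GD : set point) y z : W1D Omega GD 2 y -> W1D Omega GD 2 z ->
  W1D Omega GD 2 (y - z).
Proof.
move=> [Wy ty] [Wz tz]; split; first exact: W1B.
rewrite (_ : cst 0 = cst 0 - cst 0 :> (point -> R)); last by rewrite subrr.
by apply: (trace_eq_onB _ (W1_measurable Wy) (W1_measurable Wz) ty tz); rewrite ler1n.
Qed.

Lemma W1D_same_trace (GD : set point) y z h : W1 Omega 2 y -> W1 Omega 2 z ->
  trace_eq_on Omega 2 GD y h -> trace_eq_on Omega 2 GD z h -> W1D Omega GD 2 (y - z).
Proof.
move=> Wy Wz ty tz; split; first exact: W1B.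
rewrite (_ : cst 0 = h - h); last by rewrite subrr.
by apply: (trace_eq_onB _ (W1_measurable Wy) (W1_measurable Wz) ty tz); rewrite ler1n.
Qed.

Lemma W1norm0 p : 0 < p -> W1norm Omega p 0 = 0%E.
Proof.
move=> p0; rewrite /W1norm /Lpnorm.
have E : EFin \o (fun=> 0) \_ Omega = cst 0%E :> (point -> \bar R).
  by apply/funext => x; rewrite /= restrictRE; case: ifP.
have -> : (fun x => enorm (grad (0 : sob R n) x)) = (fun=> 0).
  by apply/funext => x; rewrite /grad /= enorm0.
by rewrite E Lnorm0 ?gt_eqF// adde0.
Qed.

Lemma W1_0 p : 0 < p -> W1 Omega p 0.
Proof.
move=> p0; split; first exact: Lp0.
- move=> i; have -> : (fun x => grad (0 : sob R n) x 0 i) = cst 0.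
    by apply/funext => x; rewrite /grad /= mxE.
  exact: Lp0.
- have int0 h : \int[mu]_(x in Omega) (0 * h x) = 0.
    rewrite (@eq_Rintegral _ _ _ mu Omega (cst 0)); last by move=> x _; rewrite mul0r.
    by rewrite (Rintegral_cst _ (measurable_Omega openO)) mul0r.
  move=> phi _ _ i; rewrite int0.
  rewrite (@eq_Rintegral _ _ _ mu Omega (fun x => 0 * phi x)) ?int0 ?oppr0// => x _.
  by rewrite /grad /= mxE.
Qed.

Lemma W1D0 (GD : set point) p : 0 < p -> W1D Omega GD p 0.
Proof.
move=> p0; split; first exact: W1_0.
exists (cst 0); last exact: aeW.
have L0 : Lpsurfnorm (boundary Omega) p (cst 0) = 0%E.
  rewrite /Lpsurfnorm (_ : _ \o _ = cst 0%E) ?Lnorm0 ?gt_eqF//.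
  by apply/funext => x; rewrite /= patchE; case: ifP.
split.
  apply/LpsurfP; split; last by rewrite L0.
  by apply/(measurable_restrictT _ measurable_boundary).
exists (fun=> 0); split.
- by move=> _; exact: smooth0.
- by rewrite classical0 subrr W1norm0//; exact: cvg_cst.
- by rewrite subrr L0; exact: cvg_cst.
Qed.

End sobolev_differences.

(** * Energy estimates *)

Section dual_norm_bounds.
Context (R : realType) (V : lmodType R).
Implicit Types (X : set V) (N : V -> \bar R) (f : V -> R).

Lemma dual_norm_ge X N f v : X v -> (N v <= 1)%E -> (`|f v|%:E <= dual_norm X N f)%E.
Proof. by move=> Xv Nv; apply: ereal_sup_ubound; exists v. Qed.

Lemma dual_norm_le X N f M :
  (forall v, X v -> (N v <= 1)%E -> `|f v| <= M) -> (dual_norm X N f <= M%:E)%E.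
Proof.
by move=> fM; apply: ge_ereal_sup => _ [v [Xv Nv] <-]; rewrite lee_fin fM.
Qed.

Lemma dual_normN X N f : dual_norm X N (fun v => - f v) = dual_norm X N f.
Proof.
congr ereal_sup; apply/seteqP.
by split=> _ [v Xv <-]; exists v => //; rewrite normrN.
Qed.

End dual_norm_bounds.

Section energy_estimates.
Context (R : realType) (n : nat) (Omega : set 'rV[R]_n.+2).
Hypotheses (openO : open Omega) (bndO : bounded_set Omega).
Notation point := 'rV[R]_n.+2.
Notation mu := (leb R n).
Implicit Types (p s q : R) (y z v : sob R n) (w u : point -> R).

Definition gradient_Lp p y := forall i, Lp Omega p (fun x => grad y x 0 i).

Lemma W1_gradient_Lp p y : W1 Omega p y -> gradient_Lp p y.
Proof. by case. Qed.

Lemma gradient_Lp_norm_le p y :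
  (Lpnorm Omega p (fun x => enorm (grad y x)) <= W1norm Omega p y)%E.
Proof. by rewrite /W1norm leeDr// Lpnorm_ge0. Qed.

Lemma W1norm_ge0 p y : (0 <= W1norm Omega p y)%E.
Proof. by rewrite /W1norm adde_ge0// Lpnorm_ge0. Qed.

Lemma W1norm_fin p y : 1 <= p -> W1 Omega p y -> W1norm Omega p y \is a fin_num.
Proof.
move=> p1 [Ly Lgy _]; rewrite /W1norm fin_numD (Lp_fin Ly).
exact: (Lp_fin (Lp_enorm openO p1 Lgy)).
Qed.

Variables s q : R.
Hypotheses (s2 : 2 < s) (hq : 2 * s / (s - 2) < q).

(** [t] is the exponent of a product of an L^s and an L^2 function, and [t'] is its conjugate; [hq]
    says that [q] exceeds [t']. *)
Let t := 2 * s / (s + 2).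
Let t' := 2 * s / (s - 2).

Let s0 : 0 < s. Proof. by move: s2; lra. Qed.
Let sm2 : 0 < s - 2. Proof. by move: s2; lra. Qed.
Let t0 : 0 < t. Proof. by rewrite /t divr_gt0//; move: s2; lra. Qed.
Let t'0 : 0 < t'. Proof. by rewrite /t' divr_gt0//; move: s2; lra. Qed.
Let q0 : 0 < q. Proof. exact: lt_trans t'0 hq. Qed.

Let s2t : s^-1 + 2^-1 = t^-1.
Proof. by rewrite /t; field; apply/andP; split; move: s2; lra. Qed.

Let t't : t'^-1 + t^-1 = 1^-1.
Proof. by rewrite /t /t'; field; rewrite !gt_eqF//; move: s2; lra. Qed.

(** Already 2s/(s-2) exceeds 1, since 2s > s - 2. Minkowski's inequality is thus available in
    L^q. *)
Lemma exponent_ge1 : 1 <= q.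
Proof.
apply/ltW/lt_trans/hq; rewrite ltr_pdivlMr//; move: s2; lra.
Qed.

Lemma Lp_triple (w : point -> R) y v : Lp Omega q w -> gradient_Lp s y -> gradient_Lp 2 v ->
  Lp Omega 1 (fun x => w x * dotp (grad y x) (grad v x)).
Proof.
move=> Lw Ly Lv.
apply: (LpM t'0 t0 ltr01 t't).
  by apply: (Lp_weaken openO bndO _ Lw); rewrite t'0.
by apply: (Lp_dotp openO s0 _ t0 _ _ s2t Ly Lv) => //; move: s2; lra.
Qed.

(** Hoelder's inequality twice: [w] in L^t' against the product of gradients in L^t, then L^s
    against L^2 for the gradients. [K] is the constant of the embedding of L^q into L^t'. *)
Lemma energy_bound : exists2 K, 0 <= K & forall (w : point -> R) y v,
  Lp Omega q w -> gradient_Lp s y -> gradient_Lp 2 v ->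
  (`|energy Omega w y v|%:E <=
   K%:E * (Lpnorm Omega q w * (W1norm Omega s y * W1norm Omega 2 v)))%E.
Proof.
have t'q : 0 < t' < q by rewrite t'0.
have [K K0 wK] := Lpnorm_weaken openO bndO t'q; exists K => // w y v Lw Ly Lv.
apply: le_trans (le_Rintegral_Lpnorm1 openO (Lp_triple Lw Ly Lv)) _.
have my i := Lp_measurable (Ly i); have mv i := Lp_measurable (Lv i).
apply: le_trans (LpnormM t'0 t0 ltr01 t't (Lp_measurable Lw) (leb_measurable_dotp openO my mv)) _.
rewrite muleA; apply: lee_pmul; rewrite ?Lpnorm_ge0//; first exact: wK (Lp_measurable Lw).
apply: le_trans (Lpnorm_dotp openO s0 _ t0 s2t my mv) _ => //.
by apply: lee_pmul; rewrite ?Lpnorm_ge0// gradient_Lp_norm_le.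
Qed.

Lemma energy_bound_le : exists2 K, 0 <= K & forall (w : point -> R) y v (a b c : R),
  Lp Omega q w -> gradient_Lp s y -> gradient_Lp 2 v ->
  (Lpnorm Omega q w <= a%:E)%E -> (W1norm Omega s y <= b%:E)%E ->
  (W1norm Omega 2 v <= c%:E)%E -> `|energy Omega w y v| <= K * (a * (b * c)).
Proof.
have [K K0 HK] := energy_bound; exists K => // w y v a b c Lw Ly Lv wa yb vc.
rewrite -lee_fin; apply: le_trans (HK _ _ _ Lw Ly Lv) _.
rewrite !EFinM.
by do 3 (apply: lee_pmul; rewrite ?lee_fin ?mule_ge0 ?Lpnorm_ge0 ?W1norm_ge0//).
Qed.

Lemma energyC w y v : energy Omega w y v = energy Omega w v y.
Proof. by apply: eq_Rintegral => x _; rewrite dotpC. Qed.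

Lemma energy_coef_linear w u y v (a : R) : Lp Omega q w -> Lp Omega q u ->
  gradient_Lp s y -> gradient_Lp 2 v ->
  energy Omega (a *: w + u) y v = a * energy Omega w y v + energy Omega u y v.
Proof.
move=> Lw Lu Ly Lv; rewrite /energy.
have Iw := Lp1_integrable openO (Lp_triple Lw Ly Lv).
have Iu := Lp1_integrable openO (Lp_triple Lu Ly Lv).
have mO := measurable_Omega openO.
rewrite -(RintegralZl _ mO Iw) -(RintegralD mO _ Iu).
  by apply: eq_Rintegral => x _; rewrite mulrA -mulrDl.
exact: (integrableZl mO a Iw).
Qed.

Lemma energyB_coef w u y v : Lp Omega q w -> Lp Omega q u ->
  gradient_Lp s y -> gradient_Lp 2 v ->
  energy Omega (w - u) y v = energy Omega w y v - energy Omega u y v.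
Proof.
move=> Lw Lu Ly Lv.
by rewrite addrC -scaleN1r energy_coef_linear// mulN1r addrC.
Qed.

Lemma energyBl w y z v : Lp Omega q w -> gradient_Lp s y -> gradient_Lp s z ->
  gradient_Lp 2 v ->
  energy Omega w (y - z) v = energy Omega w y v - energy Omega w z v.
Proof.
move=> Lw Ly Lz Lv; rewrite /energy.
rewrite -(RintegralB (measurable_Omega openO)
  (Lp1_integrable openO (Lp_triple Lw Ly Lv)) (Lp1_integrable openO (Lp_triple Lw Lz Lv))).
by apply: eq_Rintegral => x _; rewrite -mulrBr -dotpBl.
Qed.

Lemma energy_linear w y (a : R) v z : Lp Omega q w -> gradient_Lp s y ->
  gradient_Lp 2 v -> gradient_Lp 2 z ->
  energy Omega w y (a *: v + z) = a * energy Omega w y v + energy Omega w y z.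
Proof.
move=> Lw Ly Lv Lz; rewrite /energy.
have Iv := Lp1_integrable openO (Lp_triple Lw Ly Lv).
have Iz := Lp1_integrable openO (Lp_triple Lw Ly Lz).
have mO := measurable_Omega openO.
rewrite -(RintegralZl _ mO Iv) -(RintegralD mO _ Iz).
  by apply: eq_Rintegral => x _; rewrite dotpDr dotpZr; ring.
exact: (integrableZl mO a Iv).
Qed.

End energy_estimates.

(** * States with zero Dirichlet data and differences of states *)

Section control_to_state.
Context (R : realType) (n : nat) (Omega GD : set 'rV[R]_n.+2).
Hypotheses (openO : open Omega) (bndO : bounded_set Omega).
Notation point := 'rV[R]_n.+2.
Notation mu := (leb R n).
Implicit Types (p s q ul uu : R) (y z v : sob R n) (w u : point -> R).

Lemma Uad_Lp ul uu q u : 0 < ul -> 0 < q -> Uad Omega ul uu u -> Lp Omega q u.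
Proof.
move=> ul0 q0 [[L1u _] ulu].
apply: (Lp_ae_bounded openO bndO q0 (Lp_measurable L1u) (r := uu)).
apply: (@filterS _ _ (ae_filter_ringOfSetsType mu) _ _ _ ulu) => x /= + Ox.
move=> /(_ Ox) /andP[lux xuu]; rewrite ger0_norm//.
exact: le_trans (ltW ul0) lux.
Qed.

Lemma slobodeckij_seminorm_pow0 p : 0 < p ->
  slobodeckij_seminorm_pow GD p (cst 0) = 0%E.
Proof.
move=> p0; rewrite /slobodeckij_seminorm_pow integral0_eq// => x _.
by rewrite integral0_eq// => y _; rewrite subrr normr0 powR0 ?gt_eqF// mul0r.
Qed.

Lemma Lpsurfnorm0 p : 0 < p -> Lpsurfnorm GD p (cst 0) = 0%E.
Proof.
move=> p0; rewrite /Lpsurfnorm (_ : _ \o _ = cst 0%E) ?Lnorm0 ?gt_eqF//.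
by apply/funext => x; rewrite /= patchE; case: ifP.
Qed.

Lemma slobodeckij0 p : 0 < p -> slobodeckij GD p (cst 0).
Proof.
move=> p0; split; last by rewrite slobodeckij_seminorm_pow0.
rewrite /Lpsurf /= inE; apply/andP; split; rewrite inE /=.
  rewrite (_ : _ \_ _ = cst 0); first exact: measurable_cst.
  by apply/funext => x; rewrite patchE; case: ifP.
by rewrite /finite_norm [X in (X < _)%E](Lpsurfnorm0 p0).
Qed.

Lemma slobodeckij_norm0 p : 0 < p -> slobodeckij_norm GD p (cst 0) = 0%E.
Proof.
move=> p0; rewrite /slobodeckij_norm slobodeckij_seminorm_pow0// Lpsurfnorm0//.
by rewrite !poweR0r ?adde0 ?poweR0r ?invr_eq0 ?gt_eqF.
Qed.

Lemma slobodeckij_norm_lty p (h : point -> R) : slobodeckij GD p h ->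
  (slobodeckij_norm GD p h < +oo)%E.
Proof.
move=> [Lh sh]; rewrite /slobodeckij_norm poweR_lty// lte_add_pinfty// poweR_lty//.
by move: Lh; rewrite /Lpsurf /= inE => /andP[_]; rewrite inE.
Qed.

Lemma conj_exp2 : conj_exp 2 = 2 :> R.
Proof. by rewrite /conj_exp (_ : 2 - 1 = 1 :> R) ?divr1//; ring. Qed.

(** Makes the regularity estimate, which speaks of states, applicable to adjoints and to differences
    of states. The zero function serves as the lift. *)
Lemma is_state_homogeneous f u z : W1D Omega GD 2 z ->
  (forall v, W1D Omega GD 2 v -> energy Omega u z v = f v) ->
  is_state Omega GD f (cst 0) u z.
Proof.
move=> Dz zf; split=> //; first by case: Dz.
exists 0; last by rewrite subr0.
have [W0 t0] := @W1D0 R n Omega openO GD 2 (ltr0Sn R 1).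
split=> // v _; rewrite /energy.
rewrite (@eq_Rintegral _ _ _ mu Omega (cst 0)).
  by rewrite (Rintegral_cst _ (measurable_Omega openO)) mul0r.
move=> x _; rewrite /grad /= /dotp big1 ?mulr0// => i _.
by rewrite mxE mul0r.
Qed.

(** Each state comes with its own lift of [h]. The two lifts have the same trace on [GD], so their
    difference vanishes there, and [y - z] is a combination of three functions vanishing on [GD]. *)
Lemma is_state_sub f h u1 u2 y z : is_state Omega GD f h u1 y ->
  is_state Omega GD f h u2 z -> W1D Omega GD 2 (y - z).
Proof.
move=> [_ [w1 [Ww1 tw1 _] Dy] _] [_ [w2 [Ww2 tw2 _] Dz] _].
have D12 := W1D_same_trace openO bndO Ww2 Ww1 tw2 tw1.
rewrite (_ : y - z = (y - w1) - (z - w2) - (w2 - w1)).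
  exact: (W1DB openO bndO (W1DB openO bndO Dy Dz) D12).
by rewrite !opprB addrACA subrK [w2 - z - w2]addrAC subrr add0r.
Qed.

Definition linear_on (X : set (sob R n)) (f : sob R n -> R) :=
  forall (a : R) v z, X v -> X z -> f (a *: v + z) = a * f v + f z.

(* The a priori estimate for the exponent 2 and zero Dirichlet data replaces
   coercivity and the Poincare inequality. *)
Lemma homogeneous_state_bound ul uu s : regularity_exponent Omega GD ul uu s ->
  exists2 C, 0 <= C & forall u z f (M : R), Uad Omega ul uu u ->
    W1D Omega GD 2 z -> linear_on (W1D Omega GD 2) f ->
    (forall v, W1D Omega GD 2 v -> (W1norm Omega 2 v <= 1)%E -> `|f v| <= M) ->
    (forall v, W1D Omega GD 2 v -> energy Omega u z v = f v) ->
    (W1norm Omega 2 z <= (C * M)%:E)%E.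
Proof.
move=> [s2 /(_ 2)[]]; first by rewrite lexx ltW.
move=> C C0 HC; exists C => // u z f M Uu Dz lf fM zf.
have fle : (Wnegnorm Omega GD 2 f <= M%:E)%E.
  by rewrite /Wnegnorm conj_exp2; exact: dual_norm_le.
have Wf : Wneg Omega GD 2 f.
  rewrite /Wneg conj_exp2; split=> //.
  by move: fle; rewrite /Wnegnorm conj_exp2 => /le_lt_trans; apply; rewrite ltry.
have [_] := HC f (cst 0) u z Wf (slobodeckij0 (ltr0Sn R 1)) Uu (is_state_homogeneous Dz zf).
rewrite slobodeckij_norm0// add0e => /le_trans; apply.
by rewrite EFinM lee_wpmul2l.
Qed.

End control_to_state.

(** * Arithmetic of the exponents and of the first-order remainder *)

Lemma exponent_sum (R : realType) (s : R) : 2 < s ->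
  [/\ 1 <= 2 * s / (s + 2), 0 < 2 * s / (s + 2),
     s^-1 + 2^-1 = (2 * s / (s + 2))^-1 & 2^-1 + s^-1 = (2 * s / (s + 2))^-1].
Proof.
move=> s2; have t1 : 1 <= 2 * s / (s + 2) by rewrite ler_pdivlMr; lra.
have st : s^-1 + 2^-1 = (2 * s / (s + 2))^-1 by field; apply/andP; split; lra.
by split=> //; [exact: lt_le_trans t1|rewrite addrC].
Qed.

(** Half of [e] goes to the remainder of the outer function at an increment of size [c1 * r], the
    other half to a quadratic term. Adding 1 to [c1] and [c2] keeps the denominators positive when
    these constants vanish. *)
Lemma first_order_remainder (R : realType) (c1 c2 e dl : R) : 0 <= c1 -> 0 <= c2 ->
  0 < e -> 0 < dl -> exists2 d, 0 < d & forall r, 0 < r -> r < d ->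
    c1 * r < dl /\ e / (2 * (c1 + 1)) * (c1 * r) + c2 * r * r < e * r.
Proof.
move=> c10 c20 e0 dl0.
exists (Num.min (dl / (c1 + 1)) (e / (2 * (c2 + 1)))).
  by rewrite lt_min !divr_gt0// ?mulr_gt0//; lra.
move=> r r0; rewrite lt_min => /andP[]; rewrite !ltr_pdivlMr; [|lra..].
move=> rdl re; split; first by nra.
have -> : e / (2 * (c1 + 1)) * (c1 * r) + c2 * r * r =
    (e / (2 * (c1 + 1)) * c1 + c2 * r) * r by ring.
rewrite ltr_pM2r//.
have H1 : e / (2 * (c1 + 1)) * c1 <= e / 2 by rewrite mulrAC ler_pdivrMr; nra.
have H2 : c2 * r < e / 2 by nra.
lra.
Qed.

(** * Differentiability of the reduced functional and Lipschitz continuity of its gradient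
    density *)

Theorem theorem2p13 (R : realType) (n : nat) (alpha : R)
  (Omega GD GN : set 'rV[R]_n.+2) (ul uu s q : R)
  (f : sob R n -> R) (fD : 'rV[R]_n.+2 -> R)
  (S : ('rV[R]_n.+2 -> R) -> sob R n)
  (F : sob R n -> R) (DF : sob R n -> sob R n -> R)
  (Sp : sob R n -> ('rV[R]_n.+2 -> R) -> sob R n)
  (halpha : 0 < alpha <= 1)
  (hOmega : C1alpha_domain alpha Omega)
  (hGD : [/\ GD `<=` boundary Omega, GD !=set0, closed GD & (0 < surf R n GD)%E])
  (hGN : [/\ GN `<=` boundary Omega, GN !=set0, closed GN & (0 < surf R n GN)%E])
  (hreg : groger_regular (Omega `|` GN))
  (hlift : lift_well_posed Omega GD)
  (hu : 0 < ul <= uu)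
  (hs : regularity_exponent Omega GD ul uu s)
  (hq : 2 * s / (s - 2) < q)
  (hf : Wneg Omega GD s f)
  (hfD : slobodeckij GD (s : R) fD)
  (hS : forall u, Uad Omega ul uu u -> is_state Omega GD f fD u (S u))
  (hF : continuously_differentiable (W1 Omega 2) (W1norm Omega 2) F DF)
  (hFlip : exists2 L : R, 0 <= L & forall y z, W1 Omega 2 y -> W1 Omega 2 z ->
     (Wnegnorm Omega GD 2 (DF y - DF z)%R <= L%:E * W1norm Omega 2 (y - z)%R)%E)
  (hFbd : exists M : R, forall u, Uad Omega ul uu u ->
     exists g, [/\ Wneg Omega GD s g,
       (forall v, W1D Omega GD 2 v -> g v = DF (S u) v) &
       (Wnegnorm Omega GD s g <= M%:E)%E])
  (hSp : forall u y, Uad Omega ul uu u -> W1 Omega 2 y ->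
     is_adjoint Omega GD (DF y) u (Sp y u)) :
  let gg u x := dotp (grad (S u) x) (grad (Sp (S u) u) x) in
  (forall u, Uad Omega ul uu u ->
     frechet_feasible (Lp Omega q) (Lpnorm Omega q) (Uad Omega ul uu) (F \o S) u
       (fun phi => \int[leb R n]_(x in Omega) (phi x * gg u x))) /\
  (forall u, Uad Omega ul uu u -> Lp Omega (2 * s / (s + 2)) (gg u)) /\
  (exists2 L : R, 0 <= L & forall u1 u2,
     Uad Omega ul uu u1 -> Uad Omega ul uu u2 ->
     (Lpnorm Omega (2 * s / (s + 2)) (gg u1 - gg u2)%R
       <= L%:E * Lpnorm Omega q (u1 - u2)%R)%E).
Proof.
case: hOmega => openO _ _ bndO _.
have [ul0 uluu] := andP hu.
have [s2 regul] := hs.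
have s0 : 0 < s by lra.
have s1 : 1 <= s by lra.
have q1 : 1 <= q := exponent_ge1 s2 hq.
have q0 : 0 < q by lra.
have U_Lp u : Uad Omega ul uu u -> Lp Omega q u by exact: Uad_Lp.
have UB_Lp u1 u2 : Uad Omega ul uu u1 -> Uad Omega ul uu u2 -> Lp Omega q (u1 - u2).
  by move=> /U_Lp L1 /U_Lp L2; exact: LpB.
have [Cs Cs0 HCs] : exists2 C : R, 0 <= C & forall f fD u y, Wneg Omega GD s f ->
    slobodeckij GD s fD -> Uad Omega ul uu u -> is_state Omega GD f fD u y ->
    W1 Omega s y /\ (W1norm Omega s y <=
      C%:E * (slobodeckij_norm GD s fD + Wnegnorm Omega GD s f))%E.
  by apply: regul; rewrite lexx ltW.
have [B B0 SB] : exists2 B : R, 0 <= B & forall u, Uad Omega ul uu u ->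
    W1 Omega s (S u) /\ (W1norm Omega s (S u) <= B%:E)%E.
  (* The right-hand side of the regularity estimate is independent of [u], and finite because [fD]
     and [f] have finite norms. *)
  exists `|fine (Cs%:E * (slobodeckij_norm GD s fD + Wnegnorm Omega GD s f))%E| => // u Uu.
  have [WS SC] := HCs f fD u (S u) hf hfD Uu (hS _ Uu); split=> //.
  apply: (le_trans SC); rewrite -[leLHS]fineK ?lee_fin ?ler_norm//.
  rewrite ge0_fin_numE; last exact: le_trans (W1norm_ge0 _ _ _) SC.
  rewrite lte_mul_pinfty ?lee_fin// lte_add_pinfty//.
    exact: slobodeckij_norm_lty.
  by case: hf.
pose P u := Sp (S u) u.
have S_W1 u : Uad Omega ul uu u -> W1 Omega 2 (S u) by move=> /hS[].
have S_grad u : Uad Omega ul uu u -> gradient_Lp Omega s (S u).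
  by move=> /SB[WS _]; exact: W1_gradient_Lp.
have P_adj u : Uad Omega ul uu u -> is_adjoint Omega GD (DF (S u)) u (P u).
  by move=> Uu; apply: hSp => //; exact: S_W1.
have P_D u : Uad Omega ul uu u -> W1D Omega GD 2 (P u) by move=> /P_adj[].
have [B' B'0 PB] : exists2 B : R, 0 <= B & forall u, Uad Omega ul uu u ->
    W1 Omega s (P u) /\ (W1norm Omega s (P u) <= B%:E)%E.
  have [M HM] := hFbd; exists (Cs * `|M|); first by rewrite mulr_ge0.
  move=> u Uu.
  (* [g] represents F'(S u) in the dual for the exponent s' < 2. It agrees with [DF (S u)] on
     W^{1,2} functions vanishing on [GD], which suffices to make the adjoint the state for [- g]. *)
  have [g [[lg ng] gDF gM]] := HM u Uu.
  have Wg : Wneg Omega GD s (fun v => - g v).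
    split; last by rewrite dual_normN.
    by move=> a v w Xv Xw; rewrite lg// opprD mulrN.
  have Pst : is_state Omega GD (fun v => - g v) (cst 0) u (P u).
    apply: is_state_homogeneous => //; first exact: P_D.
    by move=> v Dv; rewrite gDF//; case: (P_adj u Uu) => _; apply.
  have [WP PC] := HCs _ (cst 0) u (P u) Wg (slobodeckij0 GD s0) Uu Pst; split=> //.
  apply: le_trans PC _; rewrite slobodeckij_norm0// add0e EFinM lee_wpmul2l ?lee_fin//.
  by rewrite /Wnegnorm dual_normN (le_trans gM)// lee_fin ler_norm.
have P_grad u : Uad Omega ul uu u -> gradient_Lp Omega s (P u).
  by move=> /PB[WP _]; exact: W1_gradient_Lp.
have D_grad z : W1D Omega GD 2 z -> gradient_Lp Omega 2 z.
  by move=> [Wz _]; exact: W1_gradient_Lp Wz.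
have [C2 C20 HC2] := @homogeneous_state_bound R n Omega GD openO ul uu s hs.
have [K K0 HK] := energy_bound_le openO bndO s2 hq.
(* The L^q norm as a real number; [fine] sends an infinite norm to 0, so [nqE] is restricted to
   L^q. *)
pose nq w := fine (Lpnorm Omega q w).
have nqE w : Lp Omega q w -> Lpnorm Omega q w = (nq w)%:E by move=> /Lp_fin/fineK ->.
have nq0 w : 0 <= nq w by rewrite fine_ge0// Lpnorm_ge0.
have nqN u1 u2 : nq (u1 - u2) = nq (u2 - u1).
  congr fine; apply: eq_Lpnorm => x; exact: distrC.
have SD u1 u2 : Uad Omega ul uu u1 -> Uad Omega ul uu u2 -> W1D Omega GD 2 (S u1 - S u2).
  by move=> U1 U2; exact: (is_state_sub openO bndO (hS _ U1) (hS _ U2)).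
have lin_energy w y : Lp Omega q w -> gradient_Lp Omega s y ->
    linear_on (W1D Omega GD 2) (energy Omega w y).
  move=> Lw Ly a v z /D_grad Lv /D_grad Lz.
  exact: (energy_linear openO bndO s2 hq).
have S_lip u1 u2 : Uad Omega ul uu u1 -> Uad Omega ul uu u2 ->
    (W1norm Omega 2 (S u1 - S u2)%R <= (C2 * (K * (nq (u1 - u2) * B)))%:E)%E.
  move=> U1 U2; apply: (HC2 u1 _ (energy Omega (u2 - u1) (S u2))) => //.
  - exact: SD.
  - by apply: lin_energy; [exact: UB_Lp|exact: S_grad].
  (* The inserted factor 1 is the bound on the W^{1,2} norm of the test function. *)
  - move=> v Dv v1; rewrite nqN -[B]mulr1.
    apply: HK v1; [exact: UB_Lp|exact: S_grad|exact: D_grad| |exact: (SB _ U2).2].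
    by rewrite nqE//; exact: UB_Lp.
  - move=> v Dv.
    have gv := D_grad _ Dv.
    rewrite (energyBl openO bndO s2 hq (U_Lp _ U1) (S_grad _ U1) (S_grad _ U2) gv).
    rewrite (energyB_coef openO bndO s2 hq (U_Lp _ U2) (U_Lp _ U1) (S_grad _ U2) gv).
    by have [_ _ ->//] := hS _ U1; have [_ _ ->//] := hS _ U2.
have [L L0 HL] := hFlip.
have PD u1 u2 : Uad Omega ul uu u1 -> Uad Omega ul uu u2 -> W1D Omega GD 2 (P u1 - P u2).
  by move=> /P_D D1 /P_D D2; exact: W1DB.
have P_lip u1 u2 : Uad Omega ul uu u1 -> Uad Omega ul uu u2 ->
    (W1norm Omega 2 (P u1 - P u2)%R <=
     (C2 * (L * (C2 * (K * (nq (u1 - u2) * B))) + K * (nq (u1 - u2) * B')))%:E)%E.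
  (* Subtracting the adjoint equations shows that [P u1 - P u2] solves the equation with coefficient
     [u1] and right-hand side [g]. The change of F' is controlled through [S_lip], the change of the
     coefficient through the uniform bound [B']. *)
  move=> U1 U2; pose g v := - (DF (S u1) v - DF (S u2) v) + energy Omega (u2 - u1) (P u2) v.
  have DFlin u : Uad Omega ul uu u -> linear_on (W1D Omega GD 2) (DF (S u)).
    case: hF => + _ _ Uu a v z [Wv _] [Wz _] => /(_ _ (S_W1 _ Uu))[lDF _]; exact: lDF.
  apply: (HC2 u1 _ g) => //.
  - exact: PD.
  - move=> a v z Dv Dz; rewrite /g !DFlin// lin_energy//; last 2 first.
      exact: UB_Lp. exact: P_grad.
    ring.
  - move=> v Dv v1; apply: le_trans (ler_normD _ _) _; apply: lerD.
      rewrite normrN -lee_fin.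
      apply: (@le_trans _ _ (L%:E * W1norm Omega 2 (S u1 - S u2)%R)%E).
        apply: le_trans (HL _ _ (S_W1 _ U1) (S_W1 _ U2)).
        rewrite /Wnegnorm conj_exp2.
        exact: (@dual_norm_ge _ _ _ _ (DF (S u1) - DF (S u2))).
      by rewrite EFinM lee_wpmul2l ?lee_fin// S_lip.
    rewrite nqN -[B']mulr1.
    apply: HK v1; [exact: UB_Lp|exact: P_grad|exact: D_grad| |exact: (PB _ U2).2].
    by rewrite nqE//; exact: UB_Lp.
  - move=> v Dv.
    have gv := D_grad _ Dv.
    rewrite (energyBl openO bndO s2 hq (U_Lp _ U1) (P_grad _ U1) (P_grad _ U2) gv).
    rewrite /g (energyB_coef openO bndO s2 hq (U_Lp _ U2) (U_Lp _ U1) (P_grad _ U2) gv).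
    by have [_ ->//] := P_adj _ U1; have [_ ->//] := P_adj _ U2; ring.
move=> gg; pose t := 2 * s / (s + 2).
have [t1 t0 st ts] := exponent_sum s2; rewrite -/t in t1 t0 st ts.
split; [|split].
- move=> u Uu; split.
    split=> [a v w Lv Lw|].
      exact: (energy_coef_linear openO bndO s2 hq a Lv Lw (S_grad _ Uu) (D_grad _ (P_D _ Uu))).
    (* The derivative is bounded on the unit ball of L^q: 1 bounds the variation, [B] the state in
       W^{1,s}, and the adjoint is measured in W^{1,2}. *)
    apply: (@le_lt_trans _ _ (K * (1 * (B * fine (W1norm Omega 2 (P u)))))%:E);
      last by rewrite ltry.
    apply: dual_norm_le => v Lv v1.
    apply: (HK v (S u) (P u)) => //; [exact: S_grad|exact/D_grad/P_D|exact: (SB _ Uu).2|].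
    rewrite fineK//; apply: W1norm_fin => //; first by rewrite ler1n.
    by case: (P_D _ Uu).
  move=> e e0.
  (* [c1] is the Lipschitz constant of [S] into W^{1,2}; [c2] is the constant of the quadratic
     remainder, the integral of phi grad h . grad p. *)
  pose c1 := C2 * (K * B); pose c2 := K * (c1 * B').
  have c10 : 0 <= c1 by rewrite !mulr_ge0.
  have c20 : 0 <= c2 by rewrite !mulr_ge0.
  have [_ Fdiff _] := hF.
  have e10 : 0 < e / (2 * (c1 + 1)) by rewrite divr_gt0// mulr_gt0// ltr_wpDl.
  have [dl dl0 Fdl] := Fdiff _ (S_W1 _ Uu) _ e10.
  have [d d0 Hd] := first_order_remainder c10 c20 e0 dl0.
  exists d => // phi Lphi Uphi /andP[].
  rewrite (nqE _ Lphi) !lte_fin => phi0 phid; rewrite /comp /=.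
  set r := nq phi in phi0 phid *; pose h := S (u + phi) - S u.
  have [Wh _] : W1D Omega GD 2 h by exact: SD.
  have h_le : (W1norm Omega 2 h <= (c1 * r)%:E)%E.
    apply: le_trans (S_lip _ _ Uphi Uu) _.
    by rewrite addrAC subrr add0r lee_fin /c1 /r le_eqVlt; apply/orP; left; apply/eqP; ring.
  have [rdl re] := Hd r phi0 phid.
  have hdl : (W1norm Omega 2 h < dl%:E)%E by apply: le_lt_trans h_le _.
  have := Fdl h Wh hdl; rewrite (_ : S u + h = S (u + phi)); last by rewrite addrC subrK.
  move=> Fh.
  have {}Fh : `|F (S (u + phi)) - F (S u) - DF (S u) h| <= e / (2 * (c1 + 1)) * (c1 * r).
    by rewrite -lee_fin (le_trans Fh)// [in leRHS]EFinM lee_wpmul2l// lee_fin ltW.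
  (* Both state equations have the same right-hand side at [P u], so the adjoint equation turns
     [DF (S u) h] into the energy of [S (u + phi)] and [P u] with coefficient [phi]; writing
     [S (u + phi)] as [S u + h] separates the linear term from the quadratic one. *)
  have DFh : DF (S u) h = energy Omega phi (S u) (P u) + energy Omega phi h (P u).
    have gP : gradient_Lp Omega 2 (P u) by exact/D_grad/P_D.
    have gS := S_grad _ Uu; have gS' := S_grad _ Uphi.
    rewrite (energyBl openO bndO s2 hq Lphi gS' gS gP).
    have E1 : energy Omega u (P u) h = - DF (S u) h.
      by have [_ ->//] := P_adj _ Uu; exact: SD.
    have E2 : energy Omega (u + phi - u) (S (u + phi)) (P u) =
        energy Omega (u + phi) (S (u + phi)) (P u) - energy Omega u (S (u + phi)) (P u).
      by apply: (energyB_coef openO bndO s2 hq) => //; exact: U_Lp.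
    have E3 := energyBl openO bndO s2 hq (U_Lp _ Uu) gS' gS gP.
    have E4 : energy Omega (u + phi) (S (u + phi)) (P u) = energy Omega u (S u) (P u).
      have [_ _ ->] := hS _ Uphi; last exact: P_D.
      by have [_ _ ->//] := hS _ Uu; exact: P_D.
    rewrite [u + phi - u]addrAC subrr add0r in E2.
    rewrite energyC in E1; rewrite -/h in E3; lra.
  have Eh : `|energy Omega phi h (P u)| <= K * (r * (B' * (c1 * r))).
    (* The roles are exchanged because [h] is known to be small in W^{1,2} only: [P u] takes the L^s
       slot. *)
    rewrite energyC; apply: HK h_le => //; [exact: P_grad| |by rewrite nqE|exact: (PB _ Uu).2].
    exact: W1_gradient_Lp Wh.
  have -> : \int[leb R n]_(x in Omega) (phi x * gg u x) = energy Omega phi (S u) (P u) by [].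
  rewrite ltr_pdivrMr//.
  have tri : `|F (S (u + phi)) - F (S u) - energy Omega phi (S u) (P u)| <=
      e / (2 * (c1 + 1)) * (c1 * r) + K * (r * (B' * (c1 * r))).
    apply: le_trans (lerD Fh Eh); apply: le_trans (ler_normD _ _).
    by rewrite DFh le_eqVlt; apply/orP; left; apply/eqP; congr `|_|; ring.
  apply: le_lt_trans tri _.
  by rewrite (_ : K * (r * (B' * (c1 * r))) = c2 * r * r)// /c2; ring.
- move=> u Uu.
  exact: (Lp_dotp openO s0 (ltr0Sn R 1) t0 s1 (ler1n _ 2) st (S_grad _ Uu) (D_grad _ (P_D _ Uu))).
(* The Lipschitz constants of the state and of the adjoint, from L^q to W^{1,2}. *)
- pose c1 := C2 * (K * B); pose c3 := C2 * (L * c1 + K * B').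
  have c10 : 0 <= c1 by rewrite !mulr_ge0.
  have c30 : 0 <= c3 by rewrite mulr_ge0// addr_ge0// mulr_ge0.
  exists (c1 * B' + B * c3); first by rewrite addr_ge0// mulr_ge0.
  move=> u1 u2 U1 U2; rewrite (nqE _ (UB_Lp _ _ U1 U2)).
  have mS u : Uad Omega ul uu u -> forall i, leb_measurable Omega (fun x => grad (S u) x 0 i).
    by move=> Uu i; exact: Lp_measurable (S_grad _ Uu i).
  have mP u : Uad Omega ul uu u -> forall i, leb_measurable Omega (fun x => grad (P u) x 0 i).
    by move=> Uu i; exact: Lp_measurable (P_grad _ Uu i).
  have mDS i : leb_measurable Omega (fun x => grad (S u1 - S u2) x 0 i).
    exact: Lp_measurable (D_grad _ (SD _ _ U1 U2) i).
  have mDP i : leb_measurable Omega (fun x => grad (P u1 - P u2) x 0 i).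
    exact: Lp_measurable (D_grad _ (PD _ _ U1 U2) i).
  (* In each term the difference is estimated in L^2 by its Lipschitz bound and the other factor in
     L^s by its uniform bound. *)
  have -> : gg u1 - gg u2 = fun x => dotp (grad (S u1 - S u2) x) (grad (P u1) x) +
      dotp (grad (S u2) x) (grad (P u1 - P u2) x).
    apply/funext => x; rewrite /gg /grad /= -/(P u1) -/(P u2) dotpBl dotpBr.
    by rewrite addrA subrK.
  apply: le_trans (LpnormD t1 (leb_measurable_dotp openO mDS (mP _ U1))
    (leb_measurable_dotp openO (mS _ U2) mDP)) _.
  rewrite -EFinM mulrDl EFinD; apply: leeD.
    apply: le_trans (Lpnorm_dotp openO (ltr0Sn R 1) s0 t0 ts mDS (mP _ U1)) _.
    rewrite (_ : c1 * B' * _ = c1 * nq (u1 - u2) * B'); last by ring.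
    rewrite EFinM; apply: lee_pmul; rewrite ?Lpnorm_ge0//.
      apply: le_trans (gradient_Lp_norm_le _ _ _) _; apply: le_trans (S_lip _ _ U1 U2) _.
      by rewrite lee_fin /c1 le_eqVlt; apply/orP; left; apply/eqP; ring.
    exact: le_trans (gradient_Lp_norm_le _ _ _) (PB _ U1).2.
  apply: le_trans (Lpnorm_dotp openO s0 (ltr0Sn R 1) t0 st (mS _ U2) mDP) _.
  rewrite -mulrA EFinM; apply: lee_pmul; rewrite ?Lpnorm_ge0//.
    exact: le_trans (gradient_Lp_norm_le _ _ _) (SB _ U2).2.
  apply: le_trans (gradient_Lp_norm_le _ _ _) _; apply: le_trans (P_lip _ _ U1 U2) _.
  by rewrite lee_fin /c3 /c1 le_eqVlt; apply/orP; left; apply/eqP; ring.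
Qed.
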